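(* Let $n\ge1$. The tilting algebras $\operatorname{End}(\bigoplus_i\mathcal L_i)$ of the following full strongly exceptional collections are: (1) For $\operatorname{D}^b(\operatorname{Perm}_n)$ and the collection $\{\mathcal L_{\operatorname{BP}(\Omega)}\}$ over loopless Schubert matroids $\Omega$ on $[n]$ (equivalently, up to isomorphism of line bundles, over coloopless Schubert matroids on $[n]$): the category algebra over $\Bbbk$ of the full subcategory, on the coloopless Schubert matroids on $[n]$, of the category of augmented inclusions of matroids. (2) For $\operatorname{D}^b(\operatorname{Stell}_n)$ and the collection $\{\mathcal L_{\operatorname{IP}(\Omega)}\}$ over all Schubert matroids $\Omega$ on $[n]$: the category algebra over $\Bbbk$ of the full subcategory, on all Schubert matroids on $[n]$, of the category of augmented weak maps of matroids. (3) For $\operatorname{D}^b(\operatorname{Perm}_n^B)$ and the collection $\{\mathcal L_{\operatorname{FP}(\Delta)}\}$ over loopless Schubert delta matroids $\Delta$ on $[n]$ (equivalently, up to isomorphism of line bundles, over coloopless ones): the category algebra over $\Bbbk$ of the full subcategory, on the coloopless Schubert delta matroids on $[n]$, of the category of augmented inclusions of delta matroids.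
   Context: $\Bbbk$ is an algebraically closed field of characteristic $0$; $[n]=\{1,\dots,n\}$, $[\pm n]=\{\pm1,\dots,\pm n\}$, $e_A=\sum_{i\in A}e_i$. Categories. Objects of the first two are the matroids on $[n]$, of the third the delta matroids on $[n]$. A morphism $M_1\xrightarrow{S}M_2$ is a subset $S$ of the set of loops of $M_1$ such that: (augmented inclusions of matroids) $B\cup S$ is a basis of $M_2$ for every basis $B$ of $M_1$; (augmented weak maps of matroids) $I\cup S$ is independent in $M_2$ for every independent set $I$ of $M_1$; (augmented inclusions of delta matroids) $B\cup S$ is feasible in $M_2$ for every feasible set $B$ of $M_1$. The composite of $M_1\xrightarrow{S}M_2\xrightarrow{T}M_3$ is $M_1\xrightarrow{S\cup T}M_3$; identities are $M\xrightarrow{\emptyset}M$. The category algebra of a finite category over $\Bbbk$ has the morphisms as $\Bbbk$-basis, with product the composite when defined and $0$ otherwise. Varieties and line bundles. Normal fans: cones $\overline{\{\alpha:P_\alpha=F\}}$ over faces $F$ of $P$, $P_\alpha$ the face on which $\alpha$ is maximal. For a fan $\Sigma$ in $N_{\mathbb R}$ and a lattice polytope $P\subset M_{\mathbb R}$ whose normal fan coarsens $\Sigma$, $\mathcal L_P=\mathcal O_{X_\Sigma}(\sum_\rho a_\rho D_\rho)$, $a_\rho=\max_{x\in P}\langle x,v_\rho\rangle$. $\operatorname{Perm}_n$: $M=\{x\in\mathbb Z^n:\sum x_i=0\}$, $N=\mathbb Z^n/\mathbb Z\mathbf 1$, fan with maximal cones the closures of chambers of $\{x_i=x_j\}$; for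 a lattice polytope $P\subset\mathbb R^n$ with edges parallel to vectors $e_i-e_j$, $\mathcal L_P:=\mathcal L_{P+m}$ for any $m\in\mathbb Z^n$ with $P+m\subset M_{\mathbb R}$. $\operatorname{Stell}_n$: $M=N=\mathbb Z^n$, the normal fan of $\{x\in\mathbb R^n_{\ge0}:y-x\in\mathbb R^n_{\ge0}\text{ for some }y\in\pi_n\}$, $\pi_n=\operatorname{conv}(g\cdot(1,\dots,n):g\in S_n)$. $\operatorname{Perm}^B_n$: $M=N=\mathbb Z^n$, fan with maximal cones the closures of chambers of $\{x_i=\pm x_j\ (i\neq j)\}\cup\{x_i=0\}$. Schubert matroids: for $w\in S_n$ let $\le_w$ be the induced linear order on $[n]$ and the Gale order on $k$-subsets: $\{i_1<_w\dots<_wi_k\}\le_w\{j_1<_w\dots<_wj_k\}$ iff $i_a\le_wj_a$ for all $a$. For $|S|=k$, $0\le k\le n$, $\Omega_S^w$ has bases $\{T\in\binom{[n]}k:S\le_wT\}$; Schubert matroids are the matroids of this form (including the rank $0$ matroid, with unique basis $\emptyset$). A loop lies in no basis, a coloop in every basis. $\operatorname{BP}(\Omega)=\operatorname{conv}(e_B:B\text{ basis})$, $\operatorname{IP}(\Omega)=\operatorname{conv}(e_I:I\text{ independent})$. Schubert delta matroids: a delta matroid on $[n]$ is a nonempty collection $\mathcal F$ of feasible subsets such that for $A_1,A_2\in\mathcal F$, $e\in A_1\triangle A_2$ there is $f\in A_1\triangle A_2$ with $A_1\triangle\{e,f\}\in\mathcal F$; $\operatorname{FP}=\operatorname{conv}(e_A:A\in\mathcal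 F)$; loops (coloops) are elements in no (every) feasible set. For $A=\{a_1<\dots<a_j\}$, $B=\{b_1<\dots<b_k\}$ put $A\preceq B$ iff $j\le k$ and $a_{j-i}\le b_{k-i}$ for $0\le i\le j-1$. $\Delta_S$ has feasible sets $\{T:T\preceq S\}$. Signed permutations $w\in S_n^B$ (bijections of $[\pm n]$ with $w(-i)=-w(i)$) act by $we_i=e_{w(i)}$, $e_{-j}=-e_j$; $\Delta^w_S$ has feasible polytope $w\cdot\operatorname{FP}(\Delta_S)+e_T$, $T=\{|w(i)|:i\in[n],w(i)<0\}$. Schubert delta matroids are the $\Delta_S^w$. *)

(* Defs.v *)
From HB Require Import structures.
From mathcomp Require Import all_boot all_order all_algebra.
From mathcomp Require Import all_fingroup.
From mathcomp Require Import finmap.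
From mathcomp Require Import all_classical all_reals all_analysis.

Set Implicit Arguments.
Unset Strict Implicit.
Unset Printing Implicit Defensive.

Import Order.TTheory GRing.Theory Num.Theory.
Import numFieldNormedType.Exports.

Local Open Scope classical_set_scope.
Local Open Scope ring_scope.

Definition matroid_axiom n (F : {set {set 'I_n}}) : bool :=
  (F != finset.set0) &&
  [forall B1 in F, forall B2 in F, forall x in B1 :\: B2,
     exists y in B2 :\: B1, (y |: (B1 :\ x))%SET \in F].

Record matroid n := Matroid {
  bases :> {set {set 'I_n}};
  matroidP : matroid_axiom bases }.

HB.instance Definition _ n := [isSub for @bases n].
HB.instance Definition _ n := [Finite of matroid n by <:].

Definition symdiff n (A B : {set 'I_n}) : {set 'I_n} := (A :\: B) :|: (B :\: A).

Definition delta_axiom n (F : {set {set 'I_n}}) : bool :=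
  (F != finset.set0) &&
  [forall A1 in F, forall A2 in F, forall e in symdiff A1 A2,
     exists f in symdiff A1 A2, symdiff A1 [set e; f]%SET \in F].

Record delta_matroid n := DeltaMatroid {
  feasible :> {set {set 'I_n}};
  delta_matroidP : delta_axiom feasible }.

HB.instance Definition _ n := [isSub for @feasible n].
HB.instance Definition _ n := [Finite of delta_matroid n by <:].

(* [F] is the collection of bases, resp. of feasible sets. *)
Definition loops n (F : {set {set 'I_n}}) : {set 'I_n} :=
  [set i | [forall B in F, i \notin B]]%SET.
Definition coloops n (F : {set {set 'I_n}}) : {set 'I_n} :=
  [set i | [forall B in F, i \in B]]%SET.
Definition loopless n (F : {set {set 'I_n}}) : bool := loops F == finset.set0.
Definition coloopless n (F : {set {set 'I_n}}) : bool :=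
  coloops F == finset.set0.

Definition independents n (F : {set {set 'I_n}}) : {set {set 'I_n}} :=
  [set I : {set 'I_n} | [exists B in F, I \subset B]]%SET.

(* The order w(0) <_w w(1) <_w ... *)
Definition le_perm n (w : {perm 'I_n}) : rel 'I_n :=
  fun i j => ((w^-1)%g i <= (w^-1)%g j)%N.

(* [all2] also requires both sets to have the same size. *)
Definition gale n (w : {perm 'I_n}) : rel {set 'I_n} :=
  fun S T => all2 (le_perm w) (sort (le_perm w) (enum S))
                              (sort (le_perm w) (enum T)).

Definition schubert n (M : matroid n) : bool :=
  [exists w : {perm 'I_n}, exists S : {set 'I_n},
     bases M == [set T | gale w S T]%SET].

Section Polytopes.
Context {R : realType} {n : nat}.
Implicit Types (P : set 'rV[R]_n) (F : {set {set 'I_n}}).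

Definition conv (A : set 'rV[R]_n) : set 'rV[R]_n :=
  [set x | exists m (t : 'I_m -> R) (p : 'I_m -> 'rV[R]_n),
     [/\ forall i, 0 <= t i, forall i, A (p i), \sum_i t i = 1
       & x = \sum_i t i *: p i]].

Definition evec (A : {set 'I_n}) : 'rV[R]_n := \row_i (i \in A)%:R.

Definition indicator_polytope F : set 'rV[R]_n :=
  conv [set evec B | B in [set B | B \in F]].

Definition BP (M : matroid n) := indicator_polytope (bases M).
Definition IP (M : matroid n) := indicator_polytope (independents (bases M)).
Definition FP (D : delta_matroid n) := indicator_polytope (feasible D).

Definition translate P (m : 'rV[R]_n) : set 'rV[R]_n :=
  [set x + m | x in P].

End Polytopes.

Notation vecR R := (map_mx (intr : int -> R)).

(* [enum] lists a set increasingly; entry [i] of the reversed list of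
   {a_1 < ... < a_j} is a_{j-i}. *)
Definition gale_delta n : rel {set 'I_n} := fun A B =>
  let a := rev [seq val i | i <- enum A] in
  let b := rev [seq val i | i <- enum B] in
  (size a <= size b)%N &&
  all (fun i => nth 0 a i <= nth 0 b i)%N (iota 0 (size a)).

(* [(false, i)] stands for the element i of [+-n], and [(true, i)] for -i. *)
Definition signed_perm n (w : {perm (bool * 'I_n)%type}) : bool :=
  [forall b, forall i, w (~~ b, i) == (~~ (w (b, i)).1, (w (b, i)).2)].

Section SignedAction.
Context {R : realType} {n : nat}.
Implicit Type w : {perm (bool * 'I_n)%type}.

Definition sevec (j : bool * 'I_n) : 'rV[R]_n :=
  (if j.1 then -1 else 1) *: delta_mx 0 j.2.

Definition signed_act w (x : 'rV[R]_n) : 'rV[R]_n :=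
  \sum_i x 0 i *: sevec (w (false, i)).

Definition neg_set w : {set 'I_n} :=
  [set (w (false, i)).2 | i : 'I_n & (w (false, i)).1]%SET.

End SignedAction.

Definition schubert_delta (R : realType) n (D : delta_matroid n) : bool :=
  `[< exists w (S : {set 'I_n}), signed_perm w /\
      FP D = translate
        [set signed_act w x
           | x in indicator_polytope [set T | gale_delta T S]%SET]
        (evec (neg_set w)) :> set 'rV[R]_n >].

Record fincat := FinCat {
  ob :> finType;
  hom : ob -> ob -> finType;
  idm : forall x, hom x x;
  cmp : forall x y z, hom y z -> hom x y -> hom x z;
  cmpA : forall x y z t (f : hom z t) (g : hom y z) (h : hom x y),
    cmp f (cmp g h) = cmp (cmp f g) h;
  cmp1m : forall x y (f : hom x y), cmp (idm y) f = f;
  cmpm1 : forall x y (f : hom x y), cmp f (idm x) = f }.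

Definition full_subcat (C : fincat) (P : pred C) : fincat :=
  @FinCat {x : C | P x} (fun x y => hom (val x) (val y))
    (fun x => idm (val x)) (fun x y z => @cmp C (val x) (val y) (val z))
    (fun x y z t => @cmpA C (val x) (val y) (val z) (val t))
    (fun x y => @cmp1m C (val x) (val y))
    (fun x y => @cmpm1 C (val x) (val y)).

Section CategoryAlgebra.
Variables (k : comNzRingType) (C : fincat).

Definition arrow : finType := {p : C * C & hom p.1 p.2}.
Definition arr (x y : C) (h : hom x y) : arrow :=
  @Tagged (C * C)%type (x, y) (fun p => hom p.1 p.2) h.

(* [f] stands for the formal sum of the [f h *: h]. *)
Definition catalg : Type := {ffun arrow -> k^o}.
HB.instance Definition _ := GRing.Lmodule.copy catalg {ffun arrow -> k^o}.

Definition catalg1 : catalg := [ffun a => (a == arr (idm (tag a).1))%:R].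

(* The basis product of [f : hom y z] and [g : hom x y] is [cmp f g]. *)
Definition catalg_mul (f g : catalg) : catalg :=
  [ffun c : arrow => \sum_(y : C) \sum_(a : hom y (tag c).2)
     \sum_(b : hom (tag c).1 y | cmp a b == tagged c) f (arr a) * g (arr b)].

Lemma catalg_mulE f g x z (h : hom x z) : catalg_mul f g (arr h) =
  \sum_(y : C) \sum_(a : hom y z) \sum_(b : hom x y | cmp a b == h)
     f (arr a) * g (arr b).
Proof. by rewrite ffunE. Qed.

Lemma catalgP (f g : catalg) :
  (forall x y (h : hom x y), f (arr h) = g (arr h)) -> f = g.
Proof. by move=> fg; apply/ffunP => -[[x y] h]; apply: fg. Qed.

Lemma catalg1E x y (h : hom x y) :
  catalg1 (arr h) = (arr h == arr (idm x))%:R.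
Proof. by rewrite ffunE. Qed.

Lemma catalg_mulA : associative catalg_mul.
Proof.
move=> f g h; apply: catalgP => x t c; rewrite !catalg_mulE.
transitivity (\sum_(y : C) \sum_(a : hom y t) \sum_(z : C)
   \sum_(a' : hom z y) \sum_(b' : hom x z)
   if cmp a (cmp a' b') == c then f (arr a) * g (arr a') * h (arr b') else 0).
  apply: eq_bigr => y _; apply: eq_bigr => a _.
  under eq_bigr => b _ do rewrite catalg_mulE mulr_sumr.
  rewrite exchange_big; apply: eq_bigr => z _ /=.
  under eq_bigr => b _ do rewrite mulr_sumr.
  rewrite exchange_big; apply: eq_bigr => a' _ /=.
  under eq_bigr => b _ do rewrite mulr_sumr.
  rewrite (exchange_big_dep (fun b' => cmp a (cmp a' b') == c)) /=; last first.
    by move=> b b' /eqP <- /eqP ->.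
  rewrite [LHS]big_mkcond; apply: eq_bigr => b' _; case: eqP => // cE.
  rewrite (big_pred1 (cmp a' b')) ?mulrA // => b /=.
  by rewrite andbC eq_sym; case: eqP => // ->; rewrite cE eqxx.
transitivity (\sum_(z : C) \sum_(b' : hom x z) \sum_(y : C)
   \sum_(a : hom y t) \sum_(a' : hom z y)
   if cmp a (cmp a' b') == c then f (arr a) * g (arr a') * h (arr b') else 0).
  under eq_bigr => y _ do rewrite exchange_big /=.
  rewrite exchange_big /=; apply: eq_bigr => z _.
  rewrite [RHS]exchange_big /=; apply: eq_bigr => y _.
  rewrite [RHS]exchange_big /=; apply: eq_bigr => a _.
  by rewrite exchange_big.
apply: eq_bigr => z _; under [RHS]eq_bigr do rewrite big_mkcond /=.
rewrite [RHS]exchange_big; apply: eq_bigr => b' _ /=.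
rewrite -[RHS]big_mkcond /=.
under [RHS]eq_bigr => d _ do rewrite catalg_mulE mulr_suml.
rewrite [RHS]exchange_big; apply: eq_bigr => y _ /=.
under [RHS]eq_bigr => d _ do rewrite mulr_suml.
rewrite [RHS]exchange_big; apply: eq_bigr => a _ /=.
under [RHS]eq_bigr => d _ do rewrite mulr_suml.
rewrite (exchange_big_dep (fun a' => cmp (cmp a a') b' == c)) /=; last first.
  by move=> d a' /eqP <- /eqP ->.
rewrite [RHS]big_mkcond; apply: eq_bigr => a' _; rewrite cmpA.
case: eqP => // cE; rewrite (big_pred1 (cmp a a')) // => d /=.
by rewrite andbC eq_sym; case: eqP => // ->; rewrite cE eqxx.
Qed.

Lemma catalg_mul1l : left_id catalg1 catalg_mul.
Proof.
move=> f; apply: catalgP => x z h; rewrite catalg_mulE (bigD1 z) //=.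
rewrite [X in _ + X]big1 ?addr0 => [|y /negPf yz]; last first.
  rewrite big1 // => a _; rewrite big1 // => b _; rewrite catalg1E.
  case: eqP => [/(congr1 (fun u => (tag u).2)) /= zy|]; rewrite ?mul0r //.
  by rewrite zy eqxx in yz.
rewrite (bigD1 (idm z)) //= [X in _ + X]big1 ?addr0 => [|a /negPf az].
  rewrite (big_pred1 h) ?catalg1E ?eqxx ?mul1r // => b.
  by rewrite cmp1m.
by rewrite big1 // => b _; rewrite catalg1E /arr eq_Tagged /= az mul0r.
Qed.

Lemma catalg_mul1r : right_id catalg1 catalg_mul.
Proof.
move=> f; apply: catalgP => x z h; rewrite catalg_mulE (bigD1 x) //=.
rewrite [X in _ + X]big1 ?addr0 => [|y /negPf yx]; last first.
  rewrite big1 // => a _; rewrite big1 // => b _; rewrite catalg1E.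
  case: eqP => [/(congr1 (fun u => (tag u).2)) /= zy|]; rewrite ?mulr0 //.
  by rewrite zy eqxx in yx.
rewrite (bigD1 h) //= [X in _ + X]big1 ?addr0 => [|a /negPf ah].
  rewrite (bigD1 (idm x)) ?cmpm1 //= catalg1E eqxx mulr1.
  rewrite big1 ?addr0 // => b /andP[_ /negPf bx].
  by rewrite catalg1E /arr eq_Tagged /= bx mulr0.
apply: big1 => b /eqP abh; rewrite catalg1E /arr eq_Tagged /=.
case: eqP => [bx|]; rewrite ?mulr0 //.
by rewrite bx cmpm1 in abh; rewrite abh eqxx in ah.
Qed.

Lemma catalg_mulDl : left_distributive catalg_mul +%R.
Proof.
move=> f g h; apply: catalgP => x z c; rewrite [RHS]ffunE !catalg_mulE.
rewrite -big_split; apply: eq_bigr => y _ /=.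
rewrite -big_split; apply: eq_bigr => a _ /=.
by rewrite -big_split; apply: eq_bigr => b _ /=; rewrite ffunE mulrDl.
Qed.

Lemma catalg_mulDr : right_distributive catalg_mul +%R.
Proof.
move=> f g h; apply: catalgP => x z c; rewrite [RHS]ffunE !catalg_mulE.
rewrite -big_split; apply: eq_bigr => y _ /=.
rewrite -big_split; apply: eq_bigr => a _ /=.
by rewrite -big_split; apply: eq_bigr => b _ /=; rewrite ffunE mulrDr.
Qed.

HB.instance Definition _ := GRing.Zmodule_isPzRing.Build catalg
  catalg_mulA catalg_mul1l catalg_mul1r catalg_mulDl catalg_mulDr.

End CategoryAlgebra.

Section SetCategory.
Variables (n : nat) (T : finType) (mor : T -> T -> pred {set 'I_n}).
Hypothesis mor0 : forall M, mor M M finset.set0.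
Hypothesis morU : forall M1 M2 M3 S1 S2,
  mor M1 M2 S1 -> mor M2 M3 S2 -> mor M1 M3 (S1 :|: S2)%SET.

Definition set_hom (M1 M2 : T) : finType := {S : {set 'I_n} | mor M1 M2 S}.
Definition set_idm M : set_hom M M := exist (fun S => mor M M S) _ (mor0 M).
Definition set_cmp M1 M2 M3 (S2 : set_hom M2 M3) (S1 : set_hom M1 M2) :
    set_hom M1 M3 :=
  exist (fun S => mor M1 M3 S) _ (morU (valP S1) (valP S2)).

Fact set_cmpA M1 M2 M3 M4 (S3 : set_hom M3 M4) (S2 : set_hom M2 M3)
    (S1 : set_hom M1 M2) :
  set_cmp S3 (set_cmp S2 S1) = set_cmp (set_cmp S3 S2) S1.
Proof. by apply: val_inj; rewrite /= finset.setUA. Qed.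
Fact set_cmp1m M1 M2 (S : set_hom M1 M2) : set_cmp (set_idm M2) S = S.
Proof. by apply: val_inj; rewrite /= finset.setU0. Qed.
Fact set_cmpm1 M1 M2 (S : set_hom M1 M2) : set_cmp S (set_idm M1) = S.
Proof. by apply: val_inj; rewrite /= finset.set0U. Qed.

Definition set_cat : fincat := FinCat set_cmpA set_cmp1m set_cmpm1.

End SetCategory.

Section AugmentedCategories.
Variable n : nat.
Implicit Types (S : {set 'I_n}) (F : {set {set 'I_n}}).

Definition aug_incl F1 F2 S : bool :=
  (S \subset loops F1) && [forall B in F1, (B :|: S)%SET \in F2].

Definition aug_weak F1 F2 S : bool :=
  (S \subset loops F1) &&
  [forall I in independents F1, (I :|: S)%SET \in independents F2].

Lemma aug_incl0 F : aug_incl F F finset.set0.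
Proof.
by rewrite /aug_incl finset.sub0set; apply/forall_inP => B; rewrite finset.setU0.
Qed.

Lemma aug_weak0 F : aug_weak F F finset.set0.
Proof.
by rewrite /aug_weak finset.sub0set; apply/forall_inP => B; rewrite finset.setU0.
Qed.

Lemma aug_inclU F1 F2 F3 S1 S2 :
  aug_incl F1 F2 S1 -> aug_incl F2 F3 S2 -> aug_incl F1 F3 (S1 :|: S2)%SET.
Proof.
move=> /andP[l1 /forall_inP f1] /andP[/fintype.subsetP l2 /forall_inP f2].
apply/andP; split; last first.
  by apply/forall_inP => B /f1/f2; rewrite finset.setUA.
rewrite finset.subUset l1; apply/fintype.subsetP => i /l2.
rewrite !inE => /forall_inP il; apply/forall_inP => B /f1/il.
by rewrite inE negb_or => /andP[].
Qed.

Lemma loops_indep F i :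
  (i \in loops F) = [forall I in independents F, i \notin I].
Proof.
rewrite inE; apply/forall_inP/forall_inP => il B.
  rewrite inE => /existsP[B' /andP[/il + /fintype.subsetP s]].
  by apply: contra => /s.
by move=> BF; apply: il; rewrite inE; apply/existsP; exists B; rewrite BF /=.
Qed.

Lemma aug_weakU F1 F2 F3 S1 S2 :
  aug_weak F1 F2 S1 -> aug_weak F2 F3 S2 -> aug_weak F1 F3 (S1 :|: S2)%SET.
Proof.
move=> /andP[l1 /forall_inP f1] /andP[/fintype.subsetP l2 /forall_inP f2].
apply/andP; split; last first.
  by apply/forall_inP => B /f1/f2; rewrite finset.setUA.
rewrite finset.subUset l1; apply/fintype.subsetP => i /l2.
rewrite !loops_indep => /forall_inP il; apply/forall_inP => B /f1/il.
by rewrite inE negb_or => /andP[].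
Qed.

Definition aug_incl_matroids : fincat :=
  @set_cat n (matroid n)
    (fun M1 M2 => aug_incl (bases M1) (bases M2))
    (fun M => aug_incl0 _) (fun _ _ _ _ _ => @aug_inclU _ _ _ _ _).

Definition aug_weak_matroids : fincat :=
  @set_cat n (matroid n)
    (fun M1 M2 => aug_weak (bases M1) (bases M2))
    (fun M => aug_weak0 _) (fun _ _ _ _ _ => @aug_weakU _ _ _ _ _).

Definition aug_incl_deltas : fincat :=
  @set_cat n (delta_matroid n)
    (fun D1 D2 => aug_incl (feasible D1) (feasible D2))
    (fun D => aug_incl0 _) (fun _ _ _ _ _ => @aug_inclU _ _ _ _ _).

End AugmentedCategories.

Section Laurent.
Variables (k : comNzRingType) (n : nat).
Notation G := 'rV[int]_n.

Definition laurent : Type := {fsfun G -> k with 0}.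
HB.instance Definition _ := Choice.on laurent.

Implicit Types (f g h : laurent) (u v w : G).

Definition lconst (c : k) : laurent := [fsfun w in [fset 0 : G]%fset => c].
Definition lzero : laurent := [fsfun].
Definition lopp f : laurent := [fsfun w in finsupp f => - f w].
Definition ladd f g : laurent :=
  [fsfun w in (finsupp f `|` finsupp g)%fset => f w + g w].
Definition lmul f g : laurent :=
  [fsfun w in [fset (u + v)%R | u in finsupp f, v in finsupp g]%fset =>
     \sum_(u <- finsupp f) f u * g (w - u)].

Lemma lzeroE w : lzero w = 0.
Proof. by rewrite fsfunE. Qed.

Lemma loppE f w : lopp f w = - f w.
Proof. by rewrite fsfunE; case: finsuppP => //; rewrite oppr0. Qed.

Lemma laddE f g w : ladd f g w = f w + g w.
Proof.
rewrite fsfunE in_fsetU.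
by case: (finsuppP f); case: (finsuppP g); rewrite /= ?addr0.
Qed.

Lemma lconstE c w : lconst c w = if w == 0 then c else 0.
Proof. by rewrite fsfunE in_fset1. Qed.

Lemma lmul_sum f g w (D : {fset G}) : (finsupp f `<=` D)%fset ->
  lmul f g w = \sum_(u <- D) f u * g (w - u).
Proof.
move=> fD; rewrite fsfunE -(big_fset_incl _ fD) /=; last first.
  by move=> u _ uf; rewrite fsfun_dflt ?mul0r.
case: ifP => // /negP wN; rewrite big_seq big1 // => u uf.
case: (finsuppP g (w - u)) => [|vg]; rewrite ?mulr0 //.
by case: wN; apply/imfset2P; exists u => //; exists (w - u); rewrite ?subrKC.
Qed.

Lemma lmulE f g w : lmul f g w = \sum_(u <- finsupp f) f u * g (w - u).
Proof. exact: lmul_sum. Qed.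

Lemma finsupp_lmul f g w : w \in finsupp (lmul f g) ->
  exists u v, [/\ u \in finsupp f, v \in finsupp g & w = u + v].
Proof.
rewrite mem_finsupp fsfunE; case: ifP => [/imfset2P[u uf [v vg ->]] _|].
  by exists u, v.
by rewrite eqxx.
Qed.

Fact laddA : associative ladd.
Proof. by move=> f g h; apply/fsfunP => w; rewrite !laddE addrA. Qed.
Fact laddC : commutative ladd.
Proof. by move=> f g; apply/fsfunP => w; rewrite !laddE addrC. Qed.
Fact ladd0 : left_id lzero ladd.
Proof. by move=> f; apply/fsfunP => w; rewrite laddE lzeroE add0r. Qed.
Fact laddN : left_inverse lzero lopp ladd.
Proof. by move=> f; apply/fsfunP => w; rewrite laddE loppE lzeroE addNr. Qed.

HB.instance Definition _ := GRing.isZmodule.Build laurent laddA laddC ladd0 laddN.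

Fact lmulC : commutative lmul.
Proof.
move=> f g; apply/fsfunP => w.
pose D := (finsupp f `|` [fset w - v | v in finsupp g])%fset.
pose D' := [fset w - u | u in D]%fset.
rewrite (@lmul_sum f g w D) ?fsubsetUl // (@lmul_sum g f w D'); last first.
  apply/fsubsetP => v vg; apply/imfsetP; exists (w - v); rewrite ?subKr //=.
  by rewrite in_fsetU; apply/orP; right; apply/imfsetP; exists v.
rewrite [RHS]big_imfset /=; last by move=> u v _ _ e; apply/oppr_inj/(addrI w).
by apply: eq_bigr => u _; rewrite subKr mulrC.
Qed.

Fact lmulDl : left_distributive lmul +%R.
Proof.
move=> f g h; apply/fsfunP => w; rewrite laddE.
pose D := (finsupp f `|` finsupp g `|` finsupp (f + g)%R)%fset.
rewrite !(@lmul_sum _ _ _ D) ?fsubsetUr //; first last.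
- by rewrite /D -fsetUA fsubsetUl.
- by rewrite /D fsetUAC fsubsetUr.
by rewrite -big_split; apply: eq_bigr => u _ /=; rewrite -mulrDl -laddE.
Qed.

Fact lmulA : associative lmul.
Proof.
move=> f g h; apply/fsfunP => w; rewrite lmulE.
pose D := [fset (u + v)%R | u in finsupp f, v in finsupp g]%fset.
rewrite (@lmul_sum (lmul f g) h w D); last first.
  by apply/fsubsetP => u /finsupp_lmul [a [b [af bg ->]]]; apply/imfset2P;
    exists a => //; exists b.
under [RHS]eq_bigr => u _ do rewrite lmulE mulr_suml.
rewrite exchange_big /= big_seq [RHS]big_seq; apply: eq_bigr => a af.
pose E := [fset (a + b)%R | b in finsupp g]%fset.
rewrite lmulE mulr_sumr -(@big_fset_incl _ _ _ _ E D) /=; last first.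
- move=> u _ uE; rewrite (@fsfun_dflt _ _ _ g (u - a)) ?mulr0 ?mul0r //.
  apply: contra uE => ug; apply/imfsetP; exists (u - a) => //.
  by rewrite addrC subrK.
- apply/fsubsetP => u /imfsetP[b bg ->]; apply/imfset2P; exists a => //.
  by exists b.
rewrite [RHS]big_imfset /=; last by move=> u v _ _ e; apply: (addrI a).
apply: eq_bigr => b _; rewrite (_ : a + b - a = b) ?mulrA ?opprD ?addrA //.
by rewrite addrC addKr.
Qed.

Fact lmul1 : left_id (lconst 1) lmul.
Proof.
move=> f; apply/fsfunP => w; rewrite (@lmul_sum _ _ _ [fset 0]%fset).
  by rewrite big_seq_fset1 lconstE eqxx mul1r subr0.
by apply/fsubsetP => u; rewrite mem_finsupp lconstE in_fset1;
  case: (u == 0); rewrite ?eqxx.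
Qed.

Fact lone_neq0 : lconst 1 != 0.
Proof.
by apply/eqP => /fsfunP /(_ 0) /eqP; rewrite lconstE lzeroE eqxx oner_eq0.
Qed.

HB.instance Definition _ := GRing.Zmodule_isComNzRing.Build laurent
  lmulA lmulC lmul1 lmulDl lone_neq0.

Lemma lconstD : {morph lconst : a b / a + b}.
Proof.
move=> a b; apply/fsfunP => w; rewrite laddE !lconstE.
by case: eqP; rewrite ?addr0.
Qed.

Lemma lconstM : {morph lconst : a b / a * b}.
Proof.
move=> a b; apply/fsfunP => w; rewrite [RHS](@lmul_sum _ _ _ [fset 0]%fset).
  by rewrite big_seq_fset1 !lconstE eqxx subr0; case: eqP; rewrite ?mulr0.
by apply/fsubsetP => u; rewrite mem_finsupp lconstE in_fset1;
  case: (u == 0); rewrite ?eqxx.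
Qed.

End Laurent.

Definition dot (K : pzRingType) n (x y : 'rV[K]_n) : K :=
  \sum_i x 0 i * y 0 i.

Lemma dotDl (K : pzRingType) n (x y z : 'rV[K]_n) :
  dot (x + y) z = dot x z + dot y z.
Proof.
by rewrite -big_split; apply: eq_bigr => i _; rewrite mxE mulrDl.
Qed.

(* The lattice N is Z^n / Z l for [l = lin X], which is either 0 or primitive,
   and M is the orthogonal of l in Z^n.  A subset of N_R = R^n / R l is
   represented by its preimage in R^n, an element of N by any representative
   in Z^n. *)
Record toric_fan (R : realType) n := ToricFan {
  lin : 'rV[int]_n;
  cones : set (set 'rV[R]_n) }.

Section ToricVariety.
Context {R : realType} {n : nat}.
Variables (k : comNzRingType) (X : toric_fan R n).
Implicit Types (u v : 'rV[int]_n) (S T : set 'rV[R]_n) (s t : cones X).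
Local Notation L := (laurent k n).

Definition charM u : Prop := dot u (lin X) = 0.

Definition primitive v : Prop :=
  forall (c d : int) (w : 'rV[int]_n),
    v = c *: w + d *: lin X -> c = 1 \/ c = -1.

Definition ray v : set 'rV[R]_n :=
  [set x | exists a b : R, 0 <= a /\ x = a *: vecR R v + b *: vecR R (lin X)].

(* [v] is the primitive generator of a ray of the cone [S] of the fan. *)
Definition ray_gen S v : Prop :=
  [/\ primitive v, cones X (ray v) & ray v `<=` S].

(* The coordinate ring of the affine chart of [S], k[S^\vee \cap M]. *)
Definition regular S : set L :=
  [set f | forall u, u \in finsupp f ->
     charM u /\ forall x, S x -> 0 <= dot (vecR R u) x].

(* The O_X-modules needed here are subsheaves of the constant sheaf with value
   a k[M]-module V.  As quasi-coherent sheaves, they are given by their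
   sections on the affine charts of the cones of the fan; the chart of a face T
   of S is an open subset of the chart of S. *)
Record oxmod (V : lmodType L) := OXMod {
  sec : set 'rV[R]_n -> set V;
  sec0 : forall S, sec S 0;
  secD : forall S x y, sec S x -> sec S y -> sec S (x + y);
  secZ : forall S a x, regular S a -> sec S x -> sec S (a *: x);
  sec_res : forall S T, T `<=` S -> sec S `<=` sec T }.

Definition sections V (E : oxmod V) s : Type := sec E (val s).

(* The first axiom is linearity over the coordinate ring of the chart of [s],
   the second is compatibility with restriction. *)
Record oxhom V W (E : oxmod V) (F : oxmod W) := OXHom {
  app : forall s : cones X, sections E s -> sections F s;
  app_lin : forall s a (x y z : sections E s), regular (val s) a ->
    val z = a *: val x + val y ->
    val (app z) = a *: val (app x) + val (app y);
  app_res : forall s t (x : sections E s) (y : sections E t),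
    val t `<=` val s -> val x = val y -> val (app x) = val (app y) }.

Lemma oxhomP V W (E : oxmod V) (F : oxmod W) (f g : oxhom E F) :
  (forall s (x : sections E s), val (app f x) = val (app g x)) -> f = g.
Proof.
case: f g => [f fl fr] [g gl gr] /= fg.
have fgE : f = g.
  apply: functional_extensionality_dep => s.
  apply: functional_extensionality_dep => x.
  by apply: val_inj; apply: fg.
by case: _ / fgE in gl gr *; congr OXHom; apply: Prop_irrelevance.
Qed.

Definition mk_sec V (E : oxmod V) s x (h : sec E (val s) x) :
  sections E s := exist _ x (mem_set h).

Lemma sectionsP V (E : oxmod V) s (x : sections E s) :
  sec E (val s) (val x).
Proof. exact: set_mem (valP x). Qed.

Lemma regular_const S c : regular S (lconst n c).
Proof.
move=> u; rewrite mem_finsupp lconstE; case: (eqVneq u 0) => [-> _|_].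
  have dot0 (K : pzRingType) (x : 'rV[K]_n) : dot 0 x = 0.
    by rewrite /dot big1 // => i _; rewrite mxE mul0r.
  by split=> [|x _]; rewrite /charM ?map_mx0 dot0.
by rewrite eqxx.
Qed.

Definition oxid V (E : oxmod V) : oxhom E E.
Proof. by exists (fun _ => id). Defined.

Definition oxcomp V1 V2 V3 (E1 : oxmod V1) (E2 : oxmod V2) (E3 : oxmod V3)
  (g : oxhom E2 E3) (f : oxhom E1 E2) : oxhom E1 E3.
Proof.
exists (fun s x => app g (app f x)) => [s a x y z ra zE|s t x y ts xy].
  by apply: app_lin => //; apply: app_lin.
by apply: app_res => //; apply: app_res.
Defined.

Definition oxiso V W (E : oxmod V) (F : oxmod W) : Prop :=
  exists (f : oxhom E F) (g : oxhom F E),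
    oxcomp g f = oxid E /\ oxcomp f g = oxid F.

Section End.
Variables (V : lmodType L) (E : oxmod V).

Definition oxend : Type := oxhom E E.
HB.instance Definition _ := gen_eqMixin oxend.
HB.instance Definition _ := gen_choiceMixin oxend.

Implicit Types f g h : oxend.

Lemma secZc S c x : sec E S x -> sec E S (lconst n c *: x).
Proof. by apply: secZ; apply: regular_const. Qed.

Definition oxend_zero : oxend.
Proof.
exists (fun s _ => mk_sec (sec0 E (val s))) => //= s a x y z _ _.
by rewrite scaler0 addr0.
Defined.

Definition oxend_add f g : oxend.
Proof.
exists (fun s x => mk_sec (secD (sectionsP (app f x)) (sectionsP (app g x))))
  => /= [s a x y z ra zE|s t x y ts xy].
  by rewrite (app_lin f ra zE) (app_lin g ra zE) addrACA scalerDr.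
by rewrite (app_res f ts xy) (app_res g ts xy).
Defined.

Definition oxend_scale (c : k) f : oxend.
Proof.
exists (fun s x => mk_sec (secZc c (sectionsP (app f x))))
  => /= [s a x y z ra zE|s t x y ts xy].
  by rewrite (app_lin f ra zE) scalerDr !scalerA mulrC.
by rewrite (app_res f ts xy).
Defined.

Definition oxend_opp f := oxend_scale (-1) f.

Fact oxend_addA : associative oxend_add.
Proof. by move=> f g h; apply: oxhomP => s x /=; rewrite addrA. Qed.
Fact oxend_addC : commutative oxend_add.
Proof. by move=> f g; apply: oxhomP => s x /=; rewrite addrC. Qed.
Fact oxend_add0 : left_id oxend_zero oxend_add.
Proof. by move=> f; apply: oxhomP => s x /=; rewrite add0r. Qed.
Fact oxend_addN : left_inverse oxend_zero oxend_opp oxend_add.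
Proof.
move=> f; apply: oxhomP => s x /=.
rewrite -{2}(scale1r (val (app f x))) -scalerDl.
rewrite (_ : 1 = lconst n 1 :> L) // -lconstD addNr.
rewrite (_ : lconst n 0 = 0 :> L) ?scale0r //.
by apply/fsfunP => w; rewrite lconstE lzeroE; case: eqP.
Qed.

HB.instance Definition _ := GRing.isZmodule.Build oxend
  oxend_addA oxend_addC oxend_add0 oxend_addN.

Definition oxend_mul f g : oxend := oxcomp f g.

Fact oxend_mulA : associative oxend_mul.
Proof. by move=> f g h; apply: oxhomP. Qed.
Fact oxend_mul1l : left_id (oxid E : oxend) oxend_mul.
Proof. by move=> f; apply: oxhomP. Qed.
Fact oxend_mul1r : right_id (oxid E : oxend) oxend_mul.
Proof. by move=> f; apply: oxhomP. Qed.
Fact oxend_mulDl : left_distributive oxend_mul +%R.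
Proof. by move=> f g h; apply: oxhomP. Qed.
Fact oxend_mulDr : right_distributive oxend_mul +%R.
Proof.
move=> f g h; apply: oxhomP => s x /=.
have r1 : regular (val s) (1 : L) by exact: regular_const.
have := app_lin f (x := app g x) (y := app h x)
  (z := app (g + h : oxend) x) r1.
by rewrite !scale1r; apply.
Qed.

HB.instance Definition _ := GRing.Zmodule_isPzRing.Build oxend
  oxend_mulA oxend_mul1l oxend_mul1r oxend_mulDl oxend_mulDr.

Fact oxend_scaleA a b f :
  oxend_scale a (oxend_scale b f) = oxend_scale (a * b) f.
Proof. by apply: oxhomP => s x /=; rewrite scalerA lconstM. Qed.
Fact oxend_scale1 : left_id 1 oxend_scale.
Proof. by move=> f; apply: oxhomP => s x /=; rewrite scale1r. Qed.
Fact oxend_scaleDr : right_distributive oxend_scale +%R.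
Proof. by move=> c f g; apply: oxhomP => s x /=; rewrite scalerDr. Qed.
Fact oxend_scaleDl f : {morph oxend_scale^~ f : a b / a + b}.
Proof. by move=> a b; apply: oxhomP => s x /=; rewrite lconstD scalerDl. Qed.

HB.instance Definition _ := GRing.Zmodule_isLmodule.Build k oxend
  oxend_scaleA oxend_scale1 oxend_scaleDr oxend_scaleDl.

End End.

Section DirectSum.
Variables (I : finType) (V : lmodType L) (E : I -> oxmod V).

Definition dsum_sec S : set {ffun I -> V} :=
  [set x | forall i, sec (E i) S (x i)].

Fact dsum_sec0 S : dsum_sec S 0.
Proof. by move=> i; rewrite ffunE; apply: sec0. Qed.
Fact dsum_secD S x y : dsum_sec S x -> dsum_sec S y -> dsum_sec S (x + y).
Proof. by move=> sx sy i; rewrite ffunE; apply: secD. Qed.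
Fact dsum_secZ S a x : regular S a -> dsum_sec S x -> dsum_sec S (a *: x).
Proof. by move=> ra sx i; rewrite ffunE; apply: secZ. Qed.
Fact dsum_sec_res S T : T `<=` S -> dsum_sec S `<=` dsum_sec T.
Proof. by move=> ts x sx i; apply: sec_res ts _ (sx i). Qed.

Definition dsum : oxmod {ffun I -> V} :=
  OXMod dsum_sec0 dsum_secD dsum_secZ dsum_sec_res.

End DirectSum.

(* [D v] is the coefficient of the divisor of the ray generated by [v]. *)
Section Divisor.
Variable D : 'rV[int]_n -> R.

Definition div_sec S : set L^o :=
  [set f : L | forall u, u \in finsupp f ->
     charM u /\ forall v, ray_gen S v -> - D v <= (dot u v)%:~R].

Fact div_sec0 S : div_sec S 0.
Proof. by move=> u; rewrite mem_finsupp lzeroE eqxx. Qed.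
Fact div_secD S (f g : L^o) : div_sec S f -> div_sec S g -> div_sec S (f + g).
Proof.
move=> sf sg u; rewrite mem_finsupp [X in X != _](laddE f g) => fgu.
case: (finsuppP f u) (@sf u) => [fu0 _|uf]; last by apply.
apply: sg; rewrite mem_finsupp; apply: contra fgu => /eqP ->.
by rewrite fsfun_dflt ?add0r.
Qed.
Fact div_secZ S a (f : L^o) : regular S a -> div_sec S f -> div_sec S (a *: f).
Proof.
move=> ra sf u /finsupp_lmul[v [w [/ra[Mv vP] /sf[Mw wP] ->]]].
split; first by rewrite /charM dotDl Mv Mw addr0.
move=> r rr; rewrite dotDl intrD -[X in X <= _]add0r lerD ?wP //.
case: rr => _ _ /(_ (vecR R r)) sr.
have := vP _ (sr _); rewrite (_ : dot _ _ = (dot v r)%:~R :> R); last first.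
  by rewrite /dot rmorph_sum; apply: eq_bigr => i _; rewrite !mxE rmorphM.
by apply; exists 1, 0; rewrite ler01 scale1r scale0r addr0.
Qed.
Fact div_sec_res S T : T `<=` S -> div_sec S `<=` div_sec T.
Proof.
move=> ts f sf u /sf[Mu uP]; split=> // v [pv cv rv].
by apply: uP; split=> // x /rv/ts.
Qed.

Definition OX_div : oxmod L^o := OXMod div_sec0 div_secD div_secZ div_sec_res.

End Divisor.

(* [sup] is a maximum, as it is only used for polytopes. *)
Definition polytope_bundle (P : set 'rV[R]_n) : oxmod L^o :=
  OX_div (fun v => sup [set dot x (vecR R v) | x in P]).

Definition MR : set 'rV[R]_n := [set x | dot x (vecR R (lin X)) = 0].

End ToricVariety.

Section Varieties.
Context {R : realType} {n : nat}.
Implicit Types (P U : set 'rV[R]_n).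

Definition cone_face (s t : set 'rV[R]_n) : Prop :=
  exists a : 'rV[R]_n, (forall x, s x -> 0 <= dot a x) /\
    t = s `&` [set x | dot a x = 0].

(* [U] is the complement of a hyperplane arrangement. *)
Definition chamber_fan U : set (set 'rV[R]_n) :=
  [set t | exists2 x, U x & cone_face (closure (connected_component U x)) t].

Definition polytope_face P (a : 'rV[R]_n) : set 'rV[R]_n :=
  [set x | P x /\ forall y, P y -> dot a y <= dot a x].

(* The nonempty faces of [P] are the [polytope_face P b]. *)
Definition normal_fan P : set (set 'rV[R]_n) :=
  [set closure [set a | polytope_face P a = polytope_face P b]
     | b in [set: 'rV[R]_n]].

Definition permutohedron : set 'rV[R]_n :=
  conv [set (\row_i (g i).+1%:R : 'rV[R]_n) | g in [set: {perm 'I_n}]].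

Definition stellahedron : set 'rV[R]_n :=
  [set x | (forall i, 0 <= x 0 i) /\
     exists2 y, permutohedron y & forall i, x 0 i <= y 0 i].

Definition Perm : toric_fan R n :=
  ToricFan (const_mx 1)
    (chamber_fan [set x | forall i j, i != j -> x 0 i != x 0 j]).

Definition Stell : toric_fan R n := ToricFan 0 (normal_fan stellahedron).

Definition PermB : toric_fan R n :=
  ToricFan 0 (chamber_fan
    [set x | (forall i j, i != j -> x 0 i != x 0 j /\ x 0 i != - x 0 j) /\
             forall i, x 0 i != 0]).

End Varieties.

Arguments Perm R n : clear implicits.
Arguments Stell R n : clear implicits.
Arguments PermB R n : clear implicits.

(* Main.v *)
(* A homomorphism O(D) -> O(D') is multiplication by a Laurent polynomial, and
   the exponents [u] allowed are those with <u, v> >= D(v) - D'(v) at every ray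
   [v].  For the bundles of two polytopes P and P' with 0/1 vertices, this says
   that the translate of P by -u satisfies the inequalities of P' at the rays.
   In each of the three fans, the lattice points satisfying these inequalities
   are exactly the vertices of P'; so -u maps the vertices of P to vertices of
   P', and as P has no coloop, -u is the indicator of a set S of loops of P, that
   is, an augmented inclusion.  Composition adds the exponents.  Finally, making
   all coloops of a loopless Schubert (delta) matroid into loops translates its
   polytope and is a bijection onto the coloopless ones. *)
Require Import Defs.
From HB Require Import structures.
From mathcomp Require Import all_boot all_order all_algebra.
From mathcomp Require Import fingroup perm finmap.
From mathcomp Require Import all_classical all_reals all_analysis.
From mathcomp Require Import zify ring lra.

Set Implicit Arguments.
Unset Strict Implicit.
Unset Printing Implicit Defensive.

Import Order.TTheory GRing.Theory Num.Theory.
Import numFieldNormedType.Exports.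

(* Restores [hom], [conv] and [Perm], which mathcomp shadows. *)
Import Defs.

Local Open Scope classical_set_scope.
Local Open Scope ring_scope.

(** * Endomorphisms of a sum of line bundles *)

(** An endomorphism of the sum is only a compatible family of maps on charts, so the matrix of
    Laurent polynomials has to be extracted from it. The chart of the smallest cone is the torus:
    every summand becomes trivial there, no section is lost by restriction, and linearity leaves a
    single matrix. The inequality at a ray is then recovered on the chart of that ray, where one
    monomial, given by a vertex of the polytope maximal in that direction, generates the bundle.
    Each fan thus has to supply its smallest cone and enough rays: the indicators e_A for [Perm],
    e_A and -e_i for [Stell], the vectors with entries in {-1, 0, 1} for [PermB]. Rays of coordinate
    type confine a lattice point to the cube; one more ray, adapted to the resulting vertex, shows
    that it belongs to the family. In (1) and (3) the summands are indexed by loopless objects and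
    the category by coloopless ones. Translation vectors are therefore carried along everywhere, and
    the linear order, or the signed permutation, is modified to keep the exchanged object
    Schubert. *)

Section LaurentMonomials.
Variables (k : comNzRingType) (n : nat).
Implicit Types (f g : laurent k n) (u v w : 'rV[int]_n) (a b : k).

Definition lmono a u : laurent k n := [fsfun w in [fset u]%fset => a].

Lemma lmonoE a u w : lmono a u w = if w == u then a else 0.
Proof. by rewrite fsfunE in_fset1. Qed.

Lemma finsupp_lmono a u : {subset finsupp (lmono a u) <= [fset u]%fset}.
Proof.
by move=> w; rewrite mem_finsupp lmonoE in_fset1; case: (w == u) => //; rewrite eqxx.
Qed.

Lemma lmono_mulE a u f w : (lmono a u * f) w = a * f (w - u).
Proof.
rewrite [LHS](@lmul_sum _ _ _ f w [fset u]%fset).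
  by rewrite big_seq_fset1 lmonoE eqxx.
by apply/fsubsetP/finsupp_lmono.
Qed.

Lemma lmonoM a b u v : lmono a u * lmono b v = lmono (a * b) (u + v).
Proof.
apply/fsfunP => w; rewrite lmono_mulE !lmonoE subr_eq [v + u]addrC.
by case: eqP; rewrite ?mulr0.
Qed.

Lemma lmonoD a b u : lmono (a + b) u = lmono a u + lmono b u.
Proof.
apply/fsfunP => w; rewrite [RHS]laddE !lmonoE.
by case: eqP; rewrite ?addr0.
Qed.

Lemma lmono0 u : lmono 0 u = 0.
Proof. by apply/fsfunP => w; rewrite lmonoE [RHS]lzeroE if_same. Qed.

Lemma lmono_sum (J : finType) (P : pred J) (F : J -> k) u :
  lmono (\sum_(j | P j) F j) u = \sum_(j | P j) lmono (F j) u.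
Proof. exact: (big_morph (lmono^~ u) (fun a b => lmonoD a b u) (lmono0 u)). Qed.

Lemma lsumE (J : finType) (F : J -> laurent k n) w :
  (\sum_j F j) w = \sum_j F j w.
Proof.
exact: (big_morph (fun f : laurent k n => f w)
  (fun f g => laddE f g w) (lzeroE k w)).
Qed.

End LaurentMonomials.

Section EndomorphismsOfSums.
Context {R : realType} {n : nat}.
Variables (k : comNzRingType) (X : toric_fan R n) (I : finType) (C : fincat).
Variables (D : I -> 'rV[int]_n -> R).
Variables (idx : C -> I) (obj : I -> C).
(* An arrow [h : x -> y] acts from the bundle of [x] to the bundle of [y] as
   multiplication by the monomial of exponent [deg h]. *)
Variable deg : forall x y : C, hom x y -> 'rV[int]_n.
Hypotheses (idxK : cancel idx obj) (objK : cancel obj idx).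
Hypothesis deg_inj : forall x y, injective (@deg x y).
Hypothesis deg_cmp : forall x y z (g : hom y z) (f : hom x y),
  deg (cmp g f) = deg g + deg f.
Hypothesis degP : forall x y u,
  (charM X u /\ forall v, primitive X v -> cones X (ray X v) ->
     D (idx x) v - D (idx y) v <= (dot u v)%:~R) <->
  exists h : hom x y, deg h = u.
Hypothesis D_char : forall i v, exists2 m, charM X m &
  forall v', ray_gen X (ray X v) v' -> D i v' = - (dot m v')%:~R.
Hypothesis zero_cone : cones X (ray X 0).
Hypothesis zero_cone_sub : forall S, cones X S -> ray X 0 `<=` S.
Hypothesis lin_saturated : forall v (b : R),
  vecR R v = b *: vecR R (lin X) -> exists d, v = d *: lin X.

Local Notation L := (laurent k n).
Local Notation E := (fun i => OX_div k X (D i)).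
Local Notation DS := (dsum E).

Implicit Types (f g : catalg k C).

Let deg_idm x : deg (idm x) = 0.
Proof.
by apply: (addrI (deg (idm x))); rewrite addr0 -deg_cmp cmp1m.
Qed.

(** The matrix entry of the operator attached to [f]. Arrows from [x] to [y] have distinct
    exponents, so the coefficients of [f] at them can be read back. *)
Definition hom_series f x y : L := \sum_(h : hom x y) lmono (f (arr h)) (deg h).

Lemma hom_seriesE f x y (h : hom x y) : hom_series f x y (deg h) = f (arr h).
Proof.
rewrite lsumE (bigD1 h) //= lmonoE eqxx big1 ?addr0 // => h' /negPf h'h.
by rewrite lmonoE (inj_eq (@deg_inj x y)) eq_sym h'h.
Qed.

Lemma hom_series_lin (a : k) f g x y :
  hom_series (a *: f + g) x y = lconst n a * hom_series f x y + hom_series g x y.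
Proof.
rewrite /hom_series mulr_sumr -big_split; apply: eq_bigr => h _ /=.
by rewrite !ffunE lmonoD [lconst n a]/(lmono a 0) lmonoM add0r.
Qed.

Lemma hom_series1 x y : hom_series 1 x y = (x == y)%:R.
Proof.
have [<-{y}|xy] := eqVneq x y; last first.
  rewrite /hom_series big1 // => h _; rewrite [X in lmono X]catalg1E.
  case: eqP => [/(congr1 (fun u => (tag u).2)) /= yx|_]; last exact: lmono0.
  by rewrite yx eqxx in xy.
rewrite /hom_series (bigD1 (idm x)) //= big1 ?addr0 => [|h /negPf hx].
  by rewrite [X in lmono X]catalg1E eqxx deg_idm.
by rewrite [X in lmono X]catalg1E /arr eq_Tagged /= hx lmono0.
Qed.

(** Exponents add under composition, which turns the product of the category algebra into a matrix
    product. With the composite [h] carried as an extra summation index, the two sides differ only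
    in the order of summation. *)
Lemma hom_seriesM f g x z :
  hom_series (f * g) x z = \sum_y hom_series f y z * hom_series g x y.
Proof.
transitivity (\sum_y \sum_(a : hom y z) \sum_(b : hom x y) \sum_(h | h == cmp a b)
    lmono (f (arr a) * g (arr b)) (deg h)); last first.
  apply: eq_bigr => y _; rewrite mulr_suml; apply: eq_bigr => a _.
  rewrite mulr_sumr; apply: eq_bigr => b _.
  by rewrite big_pred1_eq lmonoM deg_cmp.
rewrite /hom_series; under eq_bigr => h _.
  rewrite [X in lmono X]catalg_mulE lmono_sum.
  under eq_bigr => y _.
    rewrite lmono_sum; under eq_bigr => a _ do rewrite lmono_sum.
    over.
  over.
rewrite exchange_big; apply: eq_bigr => y _ /=.
rewrite exchange_big; apply: eq_bigr => a _ /=.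
by rewrite (exchange_big_dep predT) //=; apply: eq_bigr => b _;
  apply: eq_bigl => h; rewrite eq_sym.
Qed.

Lemma sec_sum (V : lmodType L) (F : oxmod X V) S (J : finType) (x : J -> V) :
  (forall j, sec F S (x j)) -> sec F S (\sum_j x j).
Proof.
by move=> Fx; elim/big_ind: _ => *; [exact: sec0 | exact: secD | exact: Fx].
Qed.

(** The bound [D (idx x) v - D (idx y) v] on the exponent of [h] adds up with the bound
    [- D (idx x) v] on the exponents of [p]. *)
Lemma sec_lmono x y (h : hom x y) a S (p : L^o) :
  sec (E (idx x)) S p -> sec (E (idx y)) S (lmono a (deg h) * p : L^o).
Proof.
have [Mh hP] := (degP x y (deg h)).2 (ex_intro _ h erefl).
move=> Sp u /finsupp_lmul[u' [w [/finsupp_lmono + /Sp[Mw wP] ->]]].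
rewrite in_fset1 => /eqP ->; split; first by rewrite /charM dotDl Mh Mw addr0.
move=> v Sv; have [pv cv _] := Sv.
by have := lerD (hP v pv cv) (wP v Sv); rewrite dotDl rmorphD /= addrAC subrr add0r.
Qed.

(** Matrices are indexed by objects of [C], sections by the summands in [I]; [idx] and [obj]
    translate between the two. *)
Definition matrix_act (A : C -> C -> L) (p : {ffun I -> L^o}) : {ffun I -> L^o} :=
  [ffun j => \sum_y A y (obj j) * p (idx y)].

Lemma matrix_act_lin A a p q :
  matrix_act A (a *: p + q) = a *: matrix_act A p + matrix_act A q.
Proof.
apply/ffunP => j; rewrite !ffunE scaler_sumr -big_split; apply: eq_bigr => y _ /=.
by rewrite !ffunE mulrDr [in LHS]/GRing.scale /= mulrCA.
Qed.

Lemma sec_matrix_act f S p :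
  sec DS S p -> sec DS S (matrix_act (hom_series f) p).
Proof.
move=> Sp j; rewrite ffunE.
apply: (@sec_sum _ (E j)) => y; rewrite mulr_suml.
apply: (@sec_sum _ (E j)) => h.
by have := @sec_lmono _ _ h (f (arr h)) _ _ (Sp (idx y)); rewrite objK.
Qed.

Definition catalg_act f : oxend DS.
Proof.
exists (fun s x => mk_sec (@sec_matrix_act f _ _ (sectionsP x))) => /=.
  by move=> s a x y z _ ->; apply: matrix_act_lin.
by move=> s t x y _ /= ->.
Defined.

(** The smallest cone; its chart is the dense torus. *)
Let s0 : cones X := exist (fun S => S \in cones X) _ (mem_set zero_cone).

(** A generator on the lineality line would be [0 *: 0 + d *: lin X], and primitivity would make 0 a
    unit. Hence the conditions at rays are void on the torus. *)
Lemma zero_cone_ray_gen v : ~ ray_gen X (ray X 0) v.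
Proof.
case=> pv _ /(_ (vecR R v)) []; first by exists 1, 0; rewrite scale1r scale0r addr0 ler01.
move=> a [b [_]]; rewrite (_ : vecR R 0 = 0) ?scaler0 ?add0r; last exact: map_mx0.
move=> /lin_saturated[d vE].
by have [] := pv 0 d 0; rewrite ?scaler0 ?add0r.
Qed.

Lemma charM0 : charM X 0.
Proof. by rewrite /charM /dot big1 // => i _; rewrite mxE mul0r. Qed.

Lemma sec_zero_cone (p : {ffun I -> L^o}) :
  (forall i u, u \in finsupp (p i : L) -> charM X u) -> sec DS (ray X 0) p.
Proof. by move=> Mp i u /Mp Mu; split=> // v /zero_cone_ray_gen. Qed.

Lemma regular_zero_cone (a : L) :
  (forall u, u \in finsupp a -> charM X u) -> regular X (ray X 0) a.
Proof.
move=> Ma u /Ma Mu; split=> // x [b [c [_ ->]]].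
rewrite (_ : dot _ _ = c * (dot u (lin X))%:~R); first by rewrite Mu mulr0.
rewrite /dot rmorph_sum mulr_sumr; apply: eq_bigr => i _ /=.
by rewrite !mxE mulr0 add0r rmorphM mulrCA.
Qed.

Definition unit_sec (i : I) : {ffun I -> L^o} := [ffun j => (i == j)%:R].

Lemma unit_secP i : sec DS (ray X 0) (unit_sec i).
Proof.
apply: sec_zero_cone => j u; rewrite ffunE; case: eqP => _; last first.
  by rewrite mem_finsupp lzeroE eqxx.
by move=> /(@finsupp_lmono _ _ 1 0); rewrite in_fset1 => /eqP ->; apply: charM0.
Qed.

(* On the torus all sections are combinations of the units, so an endomorphism
   is determined by the images of the units there. *)
Definition oxend_matrix (F : oxend DS) (x y : C) : L :=
  val (app F (mk_sec (s := s0) (@unit_secP (idx x)))) (idx y).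

(** Restriction to the torus keeps the underlying element. There [p] is the combination of the units
    with its own components as coefficients, so linearity determines its image. *)
Lemma oxend_matrixE F (s : cones X) (p : sections DS s) :
  val (app F p) = matrix_act (oxend_matrix F) (val p).
Proof.
have sub : ray X 0 `<=` val s by apply: zero_cone_sub; apply: set_mem (valP s).
have p0 : sec DS (val s0) (val p) by apply: sec_res sub _ (sectionsP p).
rewrite (@app_res _ _ _ _ _ _ _ _ F s s0 p (mk_sec p0)) //.
have Mp i u : u \in finsupp (val p i : L) -> charM X u by case/(p0 i).
(* Linearity is given for one expression [a *: x + y] at a time, so [p] is assembled index by
   index. *)
pose part (P : pred I) : {ffun I -> L^o} := [ffun i => if P i then val p i else 0].
have partP P : sec DS (ray X 0) (part P).
  apply: sec_zero_cone => i u; rewrite ffunE; case: ifP => // _; first exact: Mp.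
  by rewrite mem_finsupp lzeroE eqxx.
have partE (r : seq I) : uniq r ->
    val (app F (mk_sec (s := s0) (@partP (mem r)))) =
    \sum_(i <- r) (val p i : L) *: val (app F (mk_sec (s := s0) (@unit_secP i))).
  elim: r => [_|i r IHr /= /andP[ir ur]].
    rewrite big_nil.
    have r1 : regular X (ray X 0) (1 : L) by exact: regular_const.
    (* The zero section equals 1 times itself plus itself, so its image is zero. *)
    set z := mk_sec _; have z0 : val z = 0 by apply/ffunP => i; rewrite !ffunE.
    have := @app_lin _ _ _ _ _ _ _ _ F s0 1 z z z r1.
    rewrite z0 scaler0 addr0 scale1r => /(_ erefl) zE.
    by apply: (addrI (val (app F z))); rewrite -zE addr0.
  rewrite big_cons -IHr //.
  apply: app_lin; first by apply: regular_zero_cone; apply: Mp.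
  apply/ffunP => j; rewrite !ffunE /= in_cons eq_sym.
  case: eqVneq => [<-|_] /=; last by rewrite scaler0 add0r.
  by rewrite (negPf ir) addr0 /GRing.scale /= mulr1.
rewrite (_ : mk_sec p0 = mk_sec (s := s0) (@partP (mem (index_enum I)))); last first.
  by apply: val_inj; apply/ffunP => i; rewrite ffunE /= mem_index_enum.
rewrite partE ?index_enum_uniq //; apply/ffunP => j; rewrite ffunE.
rewrite sum_ffunE (reindex idx) /=; last by exists obj => ? _.
apply: eq_bigr => y _; rewrite ffunE /oxend_matrix objK.
by rewrite [in LHS]/GRing.scale /= mulrC.
Qed.

Lemma matrix_act_inj A B :
  (forall i, matrix_act A (unit_sec i) = matrix_act B (unit_sec i)) -> A =2 B.
Proof.
move=> AB x y.
have actE M : matrix_act M (unit_sec (idx x)) (idx y) = M x y.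
  rewrite ffunE idxK (bigD1 x) //= ffunE eqxx mulr1 big1 ?addr0 // => z /negPf zx.
  by rewrite ffunE (can_eq idxK) eq_sym zx mulr0.
by rewrite -actE AB actE.
Qed.

(** The torus only shows that [u] is a character. The inequality at [v] holds because the image of
    the local generator is a section on the chart of [v], with a nonzero coefficient at [m + u]. *)
Lemma oxend_matrix_supp F x y u :
  u \in finsupp (oxend_matrix F x y) -> exists h : hom x y, deg h = u.
Proof.
move=> uF; apply/degP; split.
  have := sectionsP (app F (mk_sec (s := s0) (@unit_secP (idx x)))).
  by move=> /(_ (idx y) u uF) [].
(* The monomial of exponent [m] generates the sections on the chart of [v]. *)
move=> v pv cv; have [m Mm mP] := D_char (idx x) v.
pose sv : cones X := exist (fun S => S \in cones X) _ (mem_set cv).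
have rv : ray_gen X (ray X v) v by split.
pose p : {ffun I -> L^o} := [ffun i => if i == idx x then lmono 1 m else 0].
have Sp : sec DS (val sv) p.
  move=> i w; rewrite ffunE; case: eqP => [->|_]; last first.
    by rewrite mem_finsupp lzeroE eqxx.
  move=> /finsupp_lmono; rewrite in_fset1 => /eqP ->; split=> // v' /mP ->.
  by rewrite opprK.
have := sectionsP (app F (mk_sec Sp)) => /(_ (idx y) (m + u)).
rewrite oxend_matrixE ffunE idxK /=.
rewrite (bigD1 x) //= big1 ?addr0 => [|z /negPf zx]; last first.
  by rewrite ffunE (can_eq idxK) zx mulr0.
rewrite ffunE eqxx mulrC mem_finsupp lmono_mulE mul1r addrC addKr -mem_finsupp.
move=> /(_ uF) [_ /(_ v rv)]; rewrite dotDl rmorphD /= (mP v rv).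
by rewrite [- _ - _]addrC lerBlDr [_%:~R + _]addrC.
Qed.

Lemma catalg_actK f : oxend_matrix (catalg_act f) =2 hom_series f.
Proof.
apply: matrix_act_inj => i.
by rewrite -(oxend_matrixE (catalg_act f) (mk_sec (s := s0) (@unit_secP i))).
Qed.

(** The inverse reads each matrix entry at the exponents of the arrows. Nothing is lost, since by
    [oxend_matrix_supp] no other exponents occur. *)
Theorem catalg_oxend : exists phi : catalg k C -> oxend DS,
  [/\ bijective phi, linear phi & monoid_morphism phi].
Proof.
exists catalg_act; split.
- exists (fun F => [ffun a : arrow C =>
    oxend_matrix F (tag a).1 (tag a).2 (deg (tagged a))]) => [f|F].
    by apply: catalgP => x y h; rewrite ffunE catalg_actK hom_seriesE.
  set f := finfun _.
  have fF : hom_series f =2 oxend_matrix F.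
    move=> x y; apply/fsfunP => u.
    case: (pselect (exists h : hom x y, deg h = u)) => [[h <-]|hN].
      by rewrite hom_seriesE ffunE.
    rewrite [RHS]fsfun_dflt; last by apply/negP => /oxend_matrix_supp.
    rewrite lsumE big1 // => h _; rewrite lmonoE; case: eqP => // uh.
    by case: hN; exists h.
  apply: oxhomP => s p; rewrite [RHS]oxend_matrixE /=.
  by apply/ffunP => j; rewrite !ffunE; under eq_bigr do rewrite fF.
- move=> a f g; apply: oxhomP => s p /=; apply/ffunP => j; rewrite !ffunE.
  rewrite scaler_sumr -big_split; apply: eq_bigr => y _ /=.
  by rewrite hom_series_lin mulrDl -mulrA.
- split=> [|f g]; apply: oxhomP => s p /=; apply/ffunP => j; rewrite ffunE.
    rewrite (bigD1 (obj j)) //= hom_series1 eqxx mul1r objK big1 ?addr0 //.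
    by move=> y /negPf yj; rewrite hom_series1 yj mul0r.
  under eq_bigr do rewrite hom_seriesM mulr_suml.
  rewrite exchange_big ffunE; apply: eq_bigr => y _ /=.
  rewrite ffunE idxK mulr_sumr; apply: eq_bigr => z _.
  by rewrite mulrA.
Qed.

End EndomorphismsOfSums.

(** * Line bundles of polytopes with 0/1 vertices *)

Lemma dotC (K : comPzRingType) n (x y : 'rV[K]_n) : dot x y = dot y x.
Proof. by apply: eq_bigr => i _; rewrite mulrC. Qed.

Lemma dotZl (K : pzRingType) n a (x y : 'rV[K]_n) : dot (a *: x) y = a * dot x y.
Proof. by rewrite mulr_sumr; apply: eq_bigr => i _; rewrite mxE mulrA. Qed.

Lemma dotNl (K : pzRingType) n (x y : 'rV[K]_n) : dot (- x) y = - dot x y.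
Proof. by rewrite -scaleN1r dotZl mulN1r. Qed.

Lemma dotBl (K : pzRingType) n (x y z : 'rV[K]_n) : dot (x - y) z = dot x z - dot y z.
Proof. by rewrite dotDl dotNl. Qed.

Lemma dot_suml (K : pzRingType) n (J : finType) (Q : pred J) (x : J -> 'rV[K]_n) z :
  dot (\sum_(j | Q j) x j) z = \sum_(j | Q j) dot (x j) z.
Proof.
apply: (big_morph (fun y => dot y z) (fun x y => dotDl x y z)).
by rewrite /dot big1 // => i _; rewrite mxE mul0r.
Qed.

Lemma dotDr (K : comPzRingType) n (x y z : 'rV[K]_n) : dot x (y + z) = dot x y + dot x z.
Proof. by rewrite dotC dotDl !(dotC x). Qed.

Lemma dotZr (K : comPzRingType) n a (x y : 'rV[K]_n) : dot x (a *: y) = a * dot x y.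
Proof. by rewrite dotC dotZl dotC. Qed.

Lemma dot_vecR (R : realType) n (x y : 'rV[int]_n) :
  dot (vecR R x) (vecR R y) = (dot x y)%:~R.
Proof. by rewrite /dot rmorph_sum; apply: eq_bigr => i _; rewrite !mxE rmorphM. Qed.

Definition ivec n (A : {set 'I_n}) : 'rV[int]_n := \row_i (i \in A)%:R.

Lemma vecR_ivec (R : realType) n (A : {set 'I_n}) : vecR R (ivec A) = evec A.
Proof. by apply/rowP => i; rewrite !mxE rmorph_nat. Qed.

Lemma ivec_inj n : injective (@ivec n).
Proof.
move=> A B /rowP AB; apply/setP => i.
by have := AB i; rewrite !mxE; case: (i \in A); case: (i \in B).
Qed.

Lemma ivecU n (A B : {set 'I_n}) : [disjoint A & B]%B ->
  ivec (A :|: B)%SET = ivec A + ivec B.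
Proof.
move=> dAB; apply/rowP => i; rewrite !mxE inE.
case: (boolP (i \in A)) => [/(disjointFr dAB) ->|_]; first by rewrite addr0.
by rewrite add0r.
Qed.

Section Polytopes.
Context {R : realType} {n : nat}.
Implicit Types (A : set 'rV[R]_n) (F : {set {set 'I_n}}) (t u v z : 'rV[int]_n).

Lemma sub_conv A : A `<=` conv A.
Proof.
move=> x Ax; exists 1%N, (fun=> 1), (fun=> x); split => //.
  by rewrite big_ord1.
by rewrite big_ord1 scale1r.
Qed.

Lemma conv_dot_le A a c : (forall x, A x -> dot x a <= c) ->
  forall x, conv A x -> dot x a <= c.
Proof.
move=> Ac x [m [t [p [t0 Ap t1 ->]]]].
rewrite dot_suml -[leRHS]mul1r -t1 mulr_suml; apply: ler_sum => i _.
by rewrite dotZl ler_wpM2l //; apply: Ac.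
Qed.

(** The hypothesis says that [f] respects affine combinations; it is applied to translations and to
    coordinate reflections. *)
Lemma conv_image (f : 'rV[R]_n -> 'rV[R]_n) A :
  (forall m (t : 'I_m -> R) p, \sum_i t i = 1 ->
     f (\sum_i t i *: p i) = \sum_i t i *: f (p i)) ->
  f @` conv A = conv (f @` A).
Proof.
move=> fconv; apply/seteqP; split=> [_ [_ [m [t [p [t0 Ap t1 ->]]]] <-]|x].
  exists m, t, (f \o p); split=> // [i|]; last exact: fconv.
  by exists (p i).
case=> m [t [p [t0 Ap t1 ->]]].
have /choice[q Aq] : forall i, exists y, A y /\ f y = p i.
  by move=> i; have [y] := Ap i; exists y.
exists (\sum_i t i *: q i).
  by exists m, t, q; split=> // i; case: (Aq i).
by rewrite fconv //; apply: eq_bigr => i _; case: (Aq i) => _ ->.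
Qed.

Lemma conv_translate A (u : 'rV[R]_n) : translate (conv A) u = conv (translate A u).
Proof.
apply: conv_image => m t p t1 /=.
under [RHS]eq_bigr do rewrite scalerDr.
by rewrite big_split /= -scaler_suml t1 scale1r.
Qed.

Lemma translateD A (u v : 'rV[R]_n) : translate (translate A u) v = translate A (u + v).
Proof.
rewrite /translate image_comp; congr image.
by apply/funext => x /=; rewrite addrA.
Qed.

Lemma translate0 A : translate A 0 = A.
Proof.
rewrite /translate -[RHS]image_id; congr image.
by apply/funext => x; rewrite addr0.
Qed.

Lemma evec_indicator F B : B \in F -> indicator_polytope F (evec B : 'rV[R]_n).
Proof. by move=> FB; apply: sub_conv; exists B. Qed.

Definition vertex_polytope F t : set 'rV[R]_n :=
  translate (indicator_polytope F) (vecR R t).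

Lemma vertexP F t B : B \in F -> vertex_polytope F t (vecR R (ivec B + t)).
Proof.
move=> FB; exists (evec B); first exact: evec_indicator.
by rewrite map_mxD vecR_ivec.
Qed.

Lemma vertex_polytope_le F t a c :
  (forall B, B \in F -> dot (vecR R (ivec B + t)) a <= c) ->
  forall x, vertex_polytope F t x -> dot x a <= c.
Proof.
move=> FC x; rewrite /vertex_polytope /indicator_polytope conv_translate.
apply: conv_dot_le => _ [_ [B FB <-] <-].
by have := FC B FB; rewrite map_mxD vecR_ivec.
Qed.

Lemma sup_maximum (S : set R) m : S m -> ubound S m -> sup S = m.
Proof.
move=> Sm mub; apply/le_anti/andP; split; first by apply: ge_sup => //; exists m.
by apply: ub_le_sup => //; exists m.
Qed.

(** A linear form is maximal at a vertex, and the translation by [t] only adds a constant to it. *)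
Lemma sup_vertex_polytope F t v : F != finset.set0 ->
  exists B, [/\ B \in F,
    sup [set dot x (vecR R v) | x in vertex_polytope F t] = (dot (ivec B + t) v)%:~R
    & forall B', B' \in F -> dot (ivec B') v <= dot (ivec B) v].
Proof.
case/set0Pn => B0 FB0.
case: (Order.TotalTheory.arg_maxP (fun B => dot (ivec B) v) FB0) => B FB Bmax.
exists B; split => //; apply: sup_maximum.
  by exists (vecR R (ivec B + t)); [exact: vertexP | rewrite dot_vecR].
move=> _ [x Px <-]; apply: vertex_polytope_le Px => B' FB'.
by rewrite dot_vecR ler_int !dotDl lerD2r; apply: Bmax.
Qed.

End Polytopes.

Section PolytopeBundles.
Context {R : realType} {n : nat}.
Variables (k : comNzRingType) (X : toric_fan R n).
Implicit Types (F : {set {set 'I_n}}) (t u v z : 'rV[int]_n).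
Local Notation L := (laurent k n).

(** Translating a polytope by a character changes its divisor by a principal one, with the monomial
    of exponent [t - t'] realizing the isomorphism. *)
Lemma lshift_sec F t t' S (p : L^o) : F != finset.set0 -> charM X (t - t') ->
  sec (polytope_bundle k X (vertex_polytope F t)) S p ->
  sec (polytope_bundle k X (vertex_polytope F t')) S (lmono 1 (t - t') * p : L).
Proof.
move=> F0 M Sp u /finsupp_lmul[u' [w [/finsupp_lmono + /Sp[Mw wP] ->]]].
rewrite in_fset1 => /eqP ->; split; first by rewrite /charM dotDl M Mw addr0.
move=> v /wP.
have [B [FB -> Bmax]] := @sup_vertex_polytope R _ _ t v F0.
have [B' [FB' -> B'max]] := @sup_vertex_polytope R _ _ t' v F0.
rewrite -!rmorphN /= !ler_int !dotDl dotNl !opprD => wB.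
have := Bmax _ FB'; have := B'max _ FB; move: wB; lia.
Qed.

Definition lshift_hom F t t' (F0 : F != finset.set0) (M : charM X (t - t')) :
  oxhom (polytope_bundle k X (vertex_polytope F t))
        (polytope_bundle k X (vertex_polytope F t')).
Proof.
exists (fun s p => mk_sec (@lshift_sec _ _ _ _ _ F0 M (sectionsP p))) => /=.
  by move=> s a x y z _ ->; rewrite mulrDr [in LHS]/GRing.scale /= mulrCA.
by move=> s s' x y _ ->.
Defined.

Lemma oxiso_vertex_polytope F t t' : F != finset.set0 -> charM X (t - t') ->
  oxiso (polytope_bundle k X (vertex_polytope F t))
        (polytope_bundle k X (vertex_polytope F t')).
Proof.
move=> F0 M; have M' : charM X (t' - t) by rewrite /charM -opprB dotNl M oppr0.
exists (lshift_hom F0 M), (lshift_hom F0 M').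
by split; apply: oxhomP => s x /=;
  rewrite mulrA lmonoM mulr1 addrA subrK addrN [lmono 1 0](_ : _ = 1) ?mul1r.
Qed.

Hypothesis zero_cone : cones X (ray X 0).
Hypothesis zero_cone_sub : forall S, cones X S -> ray X 0 `<=` S.
Hypothesis lin_saturated : forall v (b : R),
  vecR R v = b *: vecR R (lin X) -> exists d, v = d *: lin X.

(* The lattice points of the polytope which the rays of the fan cut out around
   the translate of [F] by [t] are its vertices. *)
Definition cut_by_rays F t : Prop := forall z, charM X (z + t) ->
  (forall v, primitive X v -> cones X (ray X v) ->
     exists2 B, B \in F & dot z v <= dot (ivec B) v) ->
  exists2 B, B \in F & z = ivec B.

Variables (C : fincat) (I : finType) (idx : C -> I) (obj : I -> C).
Hypotheses (idxK : cancel idx obj) (objK : cancel obj idx).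
Variables (F : C -> {set {set 'I_n}}) (t : C -> 'rV[int]_n) (P : I -> set 'rV[R]_n).
Variable supp : forall x y : C, hom x y -> {set 'I_n}.
Hypothesis supp_inj : forall x y, injective (@supp x y).
Hypothesis supp_cmp : forall (x y z : C) (g : hom y z) (f : hom x y),
  supp (cmp g f) = (supp f :|: supp g)%SET.
Hypothesis suppP : forall x y S,
  aug_incl (F x) (F y) S <-> exists h : hom x y, supp h = S.
Hypothesis F_neq0 : forall x, F x != finset.set0.
Hypothesis F_coloopless : forall x, coloopless (F x).
Hypothesis PE : forall i, P i = vertex_polytope (F (obj i)) (t (obj i)).
Hypothesis P_MR : forall i, P i `<=` MR X.
Hypothesis F_cut : forall x, cut_by_rays (F x) (t x).

Lemma supp_aug x y (h : hom x y) : aug_incl (F x) (F y) (supp h).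
Proof. by apply/suppP; exists h. Qed.

(** Elements of [supp f] lie in a member of [F y], hence are not loops there, whereas [supp g]
    consists of loops of [F y]. So indicators add under composition. *)
Lemma supp_disjoint (x y z : C) (g : hom y z) (f : hom x y) :
  [disjoint supp f & supp g]%B.
Proof.
have /andP[_ /forall_inP fP] := supp_aug f.
have /andP[/fintype.subsetP gl _] := supp_aug g.
have /set0Pn[B xB] := F_neq0 x.
rewrite disjoint_sym; apply/pred0P => i /=; apply/negP => /andP[/gl + fi].
by rewrite inE => /forall_inP /(_ _ (fP _ xB)); rewrite inE fi orbT.
Qed.

(** Up to the translations of the two polytopes, the exponent is minus the indicator of the
    support. *)
Let deg x y (h : hom x y) := t x - t y - ivec (supp h).

Lemma vertex_char x B : B \in F x -> charM X (ivec B + t x).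
Proof.
move=> FB; apply/eqP; rewrite -(eqr_int R) -dot_vecR; apply/eqP.
by apply: (@P_MR (idx x)); rewrite PE idxK; apply: vertexP.
Qed.

Let supE x v : exists B, [/\ B \in F x,
    sup [set dot a (vecR R v) | a in P (idx x)] = (dot (ivec B + t x) v)%:~R
    & forall B', B' \in F x -> dot (ivec B') v <= dot (ivec B) v].
Proof. by rewrite PE idxK; apply: sup_vertex_polytope. Qed.

Lemma degP x y u :
  (charM X u /\ forall v, primitive X v -> cones X (ray X v) ->
     sup [set dot a (vecR R v) | a in P (idx x)] -
     sup [set dot a (vecR R v) | a in P (idx y)] <= (dot u v)%:~R) <->
  exists h : hom x y, deg h = u.
Proof.
split=> [[Mu uP]|[h <-]]; last first.
  have /andP[/fintype.subsetP hl /forall_inP hP] := supp_aug h.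
  have hB B : B \in F x -> ivec (B :|: supp h)%SET = ivec B + ivec (supp h).
    move=> FB; apply: ivecU; rewrite disjoint_sym; apply/pred0P => i /=.
    apply/negP => /andP[/hl]; rewrite inE => /forall_inP/(_ _ FB)/negP iB.
    exact: iB.
  split=> [|v _ _].
    have /set0Pn[B xB] := F_neq0 x.
    have := vertex_char (hP _ xB); have := vertex_char xB.
    by rewrite /charM /deg hB // !dotBl !dotDl; lia.
  have [B [xB -> _]] := supE x v; have [B' [yB' -> B'max]] := supE y v.
  rewrite -rmorphB ler_int /= /deg !dotBl !dotDl.
  have := B'max _ (hP _ xB); rewrite hB // dotDl; lia.
(* The translation applied to the vertices of [F x] once the shifts [t] are removed from both
   polytopes. *)
have [w w_def] : exists w, w = t x - t y - u by exists (t x - t y - u).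
have wP B : B \in F x -> exists2 B', B' \in F y & ivec B + w = ivec B'.
  move=> xB; apply: F_cut => [|v pv cv].
    have /set0Pn[B' yB'] := F_neq0 y.
    have := vertex_char xB; move: Mu.
    by rewrite /charM w_def !(dotDl, dotNl); lia.
  have := uP v pv cv.
  have [B1 [xB1 -> B1max]] := supE x v; have [B' [yB' -> B'max]] := supE y v.
  rewrite -rmorphB ler_int /= ![dot (ivec _ + t _) _]dotDl => h.
  exists B' => //; rewrite w_def !dotDl !dotNl.
  by have := B1max _ xB; move: h; lia.
(* As no [i] is a coloop, some basis avoids [i], hence [w 0 i] is 0 or 1. *)
pose S := [set i | w 0 i == 1]%SET.
have wE : w = ivec S.
  apply/rowP => i; rewrite mxE inE.
  have : i \notin coloops (F x) by rewrite (eqP (F_coloopless x)) inE.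
  rewrite inE negb_forall_in => /exists_inP[B xB iB].
  have [B' _ /rowP/(_ i)] := wP B xB.
  rewrite !mxE (negPf iB) add0r => ->.
  by case: (i \in B').
have wB B : B \in F x -> [disjoint S & B]%B /\ (B :|: S)%SET \in F y.
  move=> xB; have [B' yB' e] := wP B xB.
  have dSB : [disjoint S & B]%B.
    apply/pred0P => i /=; apply/negP => /andP[Si Bi].
    have /rowP/(_ i) := e; rewrite wE !mxE Si Bi.
    by case: (i \in B').
  split=> //; rewrite (_ : _ :|: _ = B')%SET //; apply: ivec_inj.
  by rewrite -e wE ivecU // disjoint_sym.
have /suppP[h hS] : aug_incl (F x) (F y) S.
  apply/andP; split.
    apply/fintype.subsetP => i Si; rewrite inE; apply/forall_inP => B /wB[dSB _].
    by rewrite (disjointFr dSB).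
  by apply/forall_inP => B /wB[].
exists h; by rewrite /deg hS -wE w_def subKr.
Qed.

Theorem catalg_oxend_polytopes : exists phi : catalg k C ->
    oxend (dsum (fun i => polytope_bundle k X (P i))),
  [/\ bijective phi, linear phi & monoid_morphism phi].
Proof.
apply: (@catalg_oxend R n k X I C _ idx obj deg) => //.
- move=> x y h1 h2 /addrI /oppr_inj /ivec_inj; exact: supp_inj.
- move=> x y z g f; rewrite /deg supp_cmp ivecU; last exact: supp_disjoint.
  by apply/rowP => i; rewrite !mxE; ring.
- exact: degP.
move=> i v; rewrite -(objK i); set x := obj i.
have [B [xB Bsup Bmax]] := supE x v.
(* The local generator is minus a vertex maximal in direction [v]. Another generator of the same ray
   is a nonnegative multiple of [v] modulo [lin X], so the same vertex is maximal for it. *)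
exists (- (ivec B + t x)); first by rewrite /charM dotNl vertex_char ?oppr0.
move=> v' [_ _ /(_ (vecR R v'))[]].
  by exists 1, 0; rewrite scale1r scale0r addr0 ler01.
move=> a [b [a0 v'E]]; rewrite dotNl rmorphN opprK /=.
have vE B' : B' \in F x ->
    (dot (ivec B' + t x) v')%:~R = a * (dot (ivec B' + t x) v)%:~R :> R.
  move=> xB'; rewrite -!dot_vecR v'E dotDr !dotZr (_ : dot _ (vecR R (lin X)) = 0).
    by rewrite mulr0 addr0.
  by rewrite dot_vecR vertex_char.
have [B' [xB' -> B'max]] := supE x v'.
apply/le_anti/andP; split; last by rewrite ler_int !dotDl lerD2r B'max.
by rewrite !vE // ler_wpM2l // ler_int !dotDl lerD2r Bmax.
Qed.

End PolytopeBundles.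

(** * Chambers of hyperplane arrangements *)

Lemma dot_delta (K : pzRingType) n i (x : 'rV[K]_n) : dot (delta_mx 0 i) x = x 0 i.
Proof.
rewrite /dot (bigD1 i) //= mxE !eqxx mul1r big1 ?addr0 // => j /negPf ji.
by rewrite mxE ji andbF mul0r.
Qed.

Lemma dot_ivec n (x : 'rV[int]_n) (A : {set 'I_n}) : dot x (ivec A) = \sum_(i in A) x 0 i.
Proof.
rewrite [RHS]big_mkcond; apply: eq_bigr => i _; rewrite mxE.
by case: (i \in A); rewrite ?mulr1 ?mulr0.
Qed.

Section Topology.
Context {R : realType} {n : nat}.
Implicit Types (a x y d : 'rV[R]_n) (A : set 'rV[R]_n).

Lemma dot_continuous a : continuous (dot a : 'rV[R]_n -> R).
Proof.
rewrite /dot; elim: (index_enum _) => [|i s IHs].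
  rewrite (_ : (fun _ => _) = cst 0); first by move=> x; apply: cst_continuous.
  by apply/funext => x; rewrite big_nil.
rewrite (_ : (fun _ => _) = (fun x => a 0 i * x 0 i + \sum_(j <- s) a 0 j * x 0 j)).
  move=> x; have cx : (fun y : 'rV[R]_n => y 0 i) @ x --> x 0 i.
    exact: coord_continuous.
  exact: cvgD (cvgM (cvg_cst (a 0 i)) cx) (IHs x).
by apply/funext => x; rewrite big_cons.
Qed.

Lemma line_continuous x d : continuous (fun t : R => x + t *: d).
Proof.
move=> t A /nbhs_ballP[e /= e0 eA]; apply: filterS (fun s => eA (x + s *: d)) _ => /=.
suff : \forall s \near t, forall i j, ball ((x + t *: d) i j) e ((x + s *: d) i j).
  by apply: filterS => s sP; split.
pose near_ij i j s := ball ((x + t *: d) i j) e ((x + s *: d) i j).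
apply: (@filter_forall R _ (fun i s => forall j, near_ij i j s) (nbhs t) _) => i.
apply: (@filter_forall R _ (near_ij i) (nbhs t) _) => j.
have : (fun s : R => x i j + s * d i j) @ t --> x i j + t * d i j.
  exact: cvgD (cvg_cst (x i j)) (cvgM cvg_id (cvg_cst (d i j))).
move=> /cvgrPdist_lt /(_ e e0).
by apply: filterS => s; rewrite /near_ij /ball /= !mxE.
Qed.

Lemma closure_line A x d : (forall t : R, 0 < t -> A (x + t *: d)) -> closure A x.
Proof.
move=> Ad B; rewrite -[x]addr0 -[X in _ + X](scale0r d).
move=> /(@line_continuous x d 0)/nbhs_ballP[e /= e0 eB].
exists (x + (e / 2) *: d); split; first by apply: Ad; rewrite divr_gt0.
apply: eB; rewrite /ball /= sub0r normrN gtr0_norm ?divr_gt0 //.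
by rewrite ltr_pdivrMr // ltr_pMr // ltr1n.
Qed.

Lemma closed_halfspace a : closed [set x | 0 <= dot a x].
Proof.
apply: (@preimage_closed _ _ (dot a) [set r : R | 0 <= r]); last exact: closed_ge.
by move=> x _; apply: dot_continuous.
Qed.

Definition arrangement_complement A : set 'rV[R]_n :=
  [set x | forall a, A a -> dot a x != 0].

(** A linear form maps a connected set to an interval, so it cannot change sign without vanishing.
    Conversely the segment from [x] to [y] stays in the complement when all signs agree. *)
Lemma component_arrangement A x : arrangement_complement A x ->
  connected_component (arrangement_complement A) x =
  [set y | forall a, A a -> 0 < dot a x * dot a y].
Proof.
move=> Ux; apply/seteqP; split=> y.
  case=> C [Cx CU Cc] Cy a Aa; rewrite ltNge; apply/negP => xy0.
  have Ci : is_interval (dot a @` C).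
    apply/connected_intervalP; apply: connected_continuous_connected => //.
    by apply: continuous_subspaceT; apply: dot_continuous.
  have Dx : (dot a @` C) (dot a x) by exists x.
  have Dy : (dot a @` C) (dot a y) by exists y.
  have [z Cz /eqP az0] : (dot a @` C) 0.
    have [ax|ax] := leP 0 (dot a x).
      apply: (Ci _ _ Dy Dx); rewrite ax andbT.
      by have := Ux a Aa; nra.
    by apply: (Ci _ _ Dx Dy); rewrite (ltW ax) /=; nra.
  by have := CU z Cz a Aa; rewrite az0.
move=> xy; exists ((fun t : R => x + t *: (y - x)) @` `[0, 1]%classic).
  split.
  - by exists 0; rewrite ?scale0r ?addr0 //= in_itv /= lexx ler01.
  - move=> z [t /=]; rewrite in_itv /= => /andP[t0 t1] <- a Aa.
    rewrite dotDr dotZr dotDr [dot a (- x)]dotC dotNl [dot x a]dotC.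
    apply: contraTneq (xy a Aa) => e; rewrite -leNgt.
    have xx : 0 < dot a x * dot a x by rewrite -expr2 exprn_even_gt0 // Ux.
    rewrite leNgt; apply/negP => xyp.
    have : (1 - t) * (dot a x * dot a x) + t * (dot a x * dot a y) = 0.
      by rewrite -[RHS](mulr0 (dot a x)) -e; ring.
    have [t_lt1|t_ge1] := ltP t 1; first by nra.
    by have -> : t = 1 by [lra]; lra.
  - apply: connected_continuous_connected; last first.
      by apply: continuous_subspaceT; apply: line_continuous.
    by apply/connected_intervalP; apply: interval_is_interval.
by exists 1; rewrite /= ?in_itv /= ?ler01 ?lexx // scale1r addrC subrK.
Qed.

(** A point [y] satisfying the weak inequalities is the limit of [y + t *: x], which satisfies the
    strict ones for positive [t]. *)
Lemma closure_component_arrangement A x : arrangement_complement A x ->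
  closure (connected_component (arrangement_complement A) x) =
  [set y | forall a, A a -> 0 <= dot a x * dot a y].
Proof.
move=> Ux; rewrite component_arrangement //; apply/seteqP; split=> y.
  move=> cy a Aa.
  have : [set y | 0 <= dot (dot a x *: a) y] y.
    apply: (closed_halfspace (a := dot a x *: a)).
    apply: closure_subset cy => z /(_ a Aa) /=.
    by rewrite dotZl => /ltW.
  by rewrite /= dotZl.
move=> xy; apply: (@closure_line _ y x) => t t0 a Aa.
rewrite dotDr dotZr mulrDr mulrCA.
apply: ltr_wpDl; first exact: xy.
by rewrite mulr_gt0 // -expr2 exprn_even_gt0 // Ux.
Qed.

Lemma chamber_fanP U A t : U = arrangement_complement A ->
  chamber_fan U t <-> exists2 x, arrangement_complement A x &
    cone_face [set y | forall a, A a -> 0 <= dot a x * dot a y] t.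
Proof.
move=> ->; split=> -[x Ux xt]; exists x => //.
  by rewrite -closure_component_arrangement.
by rewrite closure_component_arrangement.
Qed.

End Topology.

(** * The three fans *)

Lemma intM_norm_eq1 (c d : int) : `|c * d| = 1 -> c = 1 \/ c = -1.
Proof.
move=> cd; have /eqP : (absz c * absz d)%N = 1%N by rewrite -abszM; lia.
by rewrite muln_eq1 => /andP[/eqP c1 _]; lia.
Qed.

Section PermFan.
Context {R : realType} {n : nat}.
Implicit Types (A : {set 'I_n}) (x y : 'rV[R]_n).
Local Notation X := (Perm R n).

Definition braid_roots : set 'rV[R]_n :=
  [set a | exists i j, i != j /\ a = delta_mx 0 i - delta_mx 0 j].

Lemma dot_root i j x : dot (delta_mx 0 i - delta_mx 0 j) x = x 0 i - x 0 j.
Proof. by rewrite dotBl !dot_delta. Qed.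

Lemma braid_complement :
  [set x : 'rV[R]_n | forall i j, i != j ->
    x 0 i != x 0 j] = arrangement_complement braid_roots.
Proof.
apply/seteqP; split=> x Ux.
  by move=> _ [i [j [ij ->]]]; rewrite dot_root subr_eq0 Ux.
by move=> i j ij; rewrite -subr_eq0 -dot_root; apply: Ux; exists i, j.
Qed.

Lemma Perm_coneP S : cones X S <-> exists2 x : 'rV[R]_n, (forall i j, i != j ->
  x 0 i != x 0 j) &
  cone_face [set y | forall i j, 0 <= (x 0 i - x 0 j) * (y 0 i - y 0 j)] S.
Proof.
rewrite [cones X S]/=.
have kE x : [set y | forall a, braid_roots a -> 0 <= dot a x * dot a y] =
    [set y | forall i j, 0 <= (x 0 i - x 0 j) * (y 0 i - y 0 j)].
  apply/seteqP; split=> y xy.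
    move=> i j; have [->|ij] := eqVneq i j; first by rewrite subrr mul0r.
    by rewrite -!dot_root; apply: xy; exists i, j.
  by move=> _ [i [j [_ ->]]]; rewrite !dot_root.
split=> [/(chamber_fanP _ braid_complement)[x Ux]|[x Ux]]; rewrite ?kE => xS.
  by exists x => //; move: Ux; rewrite -braid_complement.
by apply/(chamber_fanP _ braid_complement); exists x; rewrite ?kE -?braid_complement.
Qed.

Lemma Perm_ray A : (0 < n)%N -> A != [set: 'I_n]%SET -> cones X (ray X (ivec A)).
Proof.
move=> n_gt0 AT; have [j0 j0A] : exists j, j \notin A.
  by apply/existsP; rewrite -negb_forall; apply: contra AT => /forallP AT;
    apply/eqP/setP => i; rewrite inE AT.
apply/Perm_coneP.
(* A generic point of a chamber in which [A] comes last; [b] vanishes on the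
   part of the chamber where the coordinates are constant on [A] and off [A]. *)
pose x : 'rV[R]_n := \row_i (i + (i \in A) * n)%:R.
have xlt i j : (x 0 i < x 0 j) = (i + (i \in A) * n < j + (j \in A) * n)%N.
  by rewrite !mxE ltr_nat.
exists x.
  move=> i j; rewrite !mxE eqr_nat; apply: contra => /eqP ij; apply/eqP/val_inj.
  by have := ltn_ord i; have := ltn_ord j; move: ij; case: (i \in A); case: (j \in A);
    rewrite ?mul1n ?mul0n /=; lia.
pose pairs := [pred p : 'I_n * 'I_n | (x 0 p.2 < x 0 p.1) && ((p.1 \in A) == (p.2 \in A))].
pose b : 'rV[R]_n := \sum_(p | pairs p) (delta_mx 0 p.1 - delta_mx 0 p.2).
have bE y : dot b y = \sum_(p | pairs p) (y 0 p.1 - y 0 p.2).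
  by rewrite dot_suml; apply: eq_bigr => p _; rewrite dot_root.
have b_ge y : (forall i j, 0 <= (x 0 i - x 0 j) * (y 0 i - y 0 j)) ->
    forall p, pairs p -> 0 <= y 0 p.1 - y 0 p.2.
  move=> xy p /andP[p21 _]; have := xy p.1 p.2.
  by rewrite pmulr_rge0 // subr_gt0.
exists b; split=> [y xy|]; first by rewrite bE; apply: sumr_ge0 => p; apply: b_ge.
apply/seteqP; split=> y.
  move=> [a [c [a0 ->]]].
  have yE i : (a *: vecR R (ivec A) + c *: vecR R (const_mx 1)) 0 i = a * (i \in A)%:R + c.
    by rewrite !mxE rmorph_nat mulr1.
  split=> [i j|]; last first.
    by rewrite /= bE big1 // => p /andP[_ /eqP ij]; rewrite !yE ij subrr.
  rewrite !yE.
  have : x 0 i < x 0 j -> ((i \in A) <= (j \in A))%N.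
    rewrite xlt; have := ltn_ord i; have := ltn_ord j.
    by case: (i \in A); case: (j \in A) => //=; rewrite ?mul1n ?mul0n; lia.
  have : x 0 j < x 0 i -> ((j \in A) <= (i \in A))%N.
    rewrite xlt; have := ltn_ord i; have := ltn_ord j.
    by case: (i \in A); case: (j \in A) => //=; rewrite ?mul1n ?mul0n; lia.
  case: (ltgtP (x 0 i) (x 0 j)) => [||->]; rewrite ?subrr ?mul0r //;
  case: (i \in A); case: (j \in A) => //= h1 h2 h3;
    rewrite ?mulr0 ?mulr1 ?subrr ?mulr0 //; try by nra.
  - by have := h3 isT.
  - by have := h2 isT.
move=> [xy by0].
have y_eq i j : (i \in A) = (j \in A) -> y 0 i = y 0 j.
  move=> ij; wlog lt_ij : i j ij / x 0 j < x 0 i.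
    move=> th; have [/th -> //|/th -> //|] := ltgtP (x 0 j) (x 0 i).
    rewrite !mxE => /eqP; rewrite eqr_nat ij => /eqP /addIn /val_inj -> //.
  have pij : pairs (i, j) by rewrite /= lt_ij ij eqxx.
  apply/eqP; rewrite -subr_eq0; apply/eqP.
  move: by0; rewrite /= bE => /eqP; rewrite psumr_eq0; last exact: b_ge.
  by move=> /allP /(_ (i, j)); rewrite mem_index_enum pij => /(_ isT) /= /eqP.
have [i0 i0A|A0] := pickP (mem A); last first.
  exists 0, (y 0 j0); split=> //; apply/rowP => i; rewrite !mxE mul0r add0r mulr1.
  by apply: y_eq; rewrite (negPf j0A); exact: A0.
exists (y 0 i0 - y 0 j0), (y 0 j0); split.
  have := xy i0 j0; rewrite pmulr_rge0 // subr_gt0 xlt (negPf j0A) [_ \in _]i0A.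
  by rewrite mul1n mul0n; have := ltn_ord j0; lia.
apply/rowP => i; rewrite !mxE rmorph_nat mulr1.
case: (boolP (i \in A)) => iA; rewrite ?mulr1 ?mulr0 ?subrK ?add0r.
  by apply: y_eq; rewrite iA; exact/esym.
by apply: y_eq; rewrite (negPf iA) (negPf j0A).
Qed.

(** Every closed chamber contains the whole line of constant vectors, and a form that is nonnegative
    on a line vanishes on it. *)
Lemma Perm_lin_sub S : cones X S -> ray X 0 `<=` S.
Proof.
move=> /Perm_coneP[x _ [b [b0 ->]]] y [a [c [_ ->]]].
have E c' i : (c' *: vecR R (const_mx 1)) 0 i = c' by rewrite !mxE mulr1.
rewrite map_mx0 scaler0 add0r; split=> [i j|] /=; first by rewrite !E subrr mulr0.
have P c' : 0 <= dot b (c' *: vecR R (const_mx 1)).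
  by apply: b0 => i j; rewrite !E subrr mulr0.
have := P c; have := P (- c); rewrite !dotZr mulNr oppr_ge0 => h1 h2.
by apply/le_anti; rewrite h1 h2.
Qed.

Lemma Perm_lin_saturated : (0 < n)%N -> forall v (b : R),
  vecR R v = b *: vecR R (lin X) -> exists d, v = d *: lin X.
Proof.
case: n => // m _ v b /rowP vb; exists (v 0 ord0); apply/rowP => i.
have := vb i; have := vb ord0; rewrite !mxE !mulr1 => <- /eqP.
by rewrite eqr_int => /eqP.
Qed.

(** Subtracting a coordinate off [A] from one in [A] removes the multiple of [lin X] and exhibits 1
    as a multiple of [c]. *)
Lemma Perm_primitive A : A != finset.set0 -> A != [set: 'I_n]%SET -> primitive X (ivec A).
Proof.
move=> /set0Pn[i iA] AT; have [j jA] : exists j, j \notin A.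
  by apply/existsP; rewrite -negb_forall; apply: contra AT => /forallP AT;
    apply/eqP/setP => k; rewrite inE AT.
move=> c d w /rowP vw; have := vw i; have := vw j.
rewrite !mxE (negPf jA) iA /= mulr1 => hj hi.
by apply: (@intM_norm_eq1 _ (w 0 i - w 0 j)); rewrite mulrBr; lia.
Qed.

End PermFan.

Section PermBFan.
Context {R : realType} {n : nat}.
Implicit Types (v : 'rV[int]_n) (x y : 'rV[R]_n) (w : 'I_n -> R) (s : 'I_n -> bool).
Local Notation X := (PermB R n).

Definition typeB_roots : set 'rV[R]_n :=
  [set a | (exists i j, i != j /\
              (a = delta_mx 0 i - delta_mx 0 j \/ a = delta_mx 0 i + delta_mx 0 j))
           \/ exists i, a = delta_mx 0 i].

Lemma typeB_complement :
  [set x : 'rV[R]_n | (forall i j, i != j -> x 0 i != x 0 j /\ x 0 i != - x 0 j) /\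
             forall i, x 0 i != 0] = arrangement_complement typeB_roots.
Proof.
apply/seteqP; split=> x.
  move=> [U2 U1] _ [[i [j [/U2[ij ij'] [->|->]]]]|[i ->]].
  - by rewrite dot_root subr_eq0.
  - by rewrite dotDl !dot_delta addr_eq0.
  - by rewrite dot_delta.
move=> Ux; split=> [i j ij|i]; last by rewrite -dot_delta; apply: Ux; right; exists i.
split; first by rewrite -subr_eq0 -dot_root; apply: Ux; left; exists i, j; auto.
by rewrite -addr_eq0 -!dot_delta -dotDl; apply: Ux; left; exists i, j; auto.
Qed.

(* The closed chamber of the point of signs [s] and absolute values [w]. *)
Definition typeB_chamber s w : set 'rV[R]_n :=
  [set y | forall i, 0 <= (-1) ^+ s i * y 0 i /\
     forall j, w j < w i -> (-1) ^+ s j * y 0 j <= (-1) ^+ s i * y 0 i].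

Lemma PermB_coneP S : cones X S <-> exists s w,
  [/\ injective w, forall i, 0 < w i & cone_face (typeB_chamber s w) S].
Proof.
have chE s w x : injective w -> (forall i, 0 < w i) ->
    (forall i, x 0 i = (-1) ^+ s i * w i) ->
    [set y | forall a, typeB_roots a -> 0 <= dot a x * dot a y] = typeB_chamber s w.
  move=> w_inj w0 xE; apply/seteqP; split=> y xy; last first.
    have [z zE] : exists z : 'I_n -> R, forall i, (-1) ^+ s i * y 0 i = z i by eexists.
    have yE i : y 0 i = (-1) ^+ s i * z i by rewrite -zE signrMK.
    have z0 i : 0 <= z i by rewrite -zE; have [] := xy i.
    (* These two products are the conditions for the roots e_i - e_j and e_i + e_j, in this order if
       the signs at [i] and [j] agree and swapped otherwise. *)
    have zw i j : 0 <= (w i - w j) * (z i - z j).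
      have [wji|wij|->] := ltgtP (w j) (w i); last by rewrite subrr mul0r.
        by rewrite mulr_ge0 ?subr_ge0 ?(ltW wji) // -!zE; have [_] := xy i; apply.
      by rewrite mulr_le0 ?subr_le0 ?(ltW wij) // -!zE; have [_] := xy j; apply.
    have wz i j : 0 <= (w i + w j) * (z i + z j) by rewrite mulr_ge0 ?addr_ge0 // ltW.
    move=> _ [[i [j [_ [->|->]]]]|[i ->]]; rewrite ?dot_root ?dotDl ?dot_delta !xE !yE.
    - by move: (zw i j) (wz i j); case: (s i); case: (s j); rewrite /= ?expr0 ?expr1; lra.
    - by move: (zw i j) (wz i j); case: (s i); case: (s j); rewrite /= ?expr0 ?expr1; lra.
    - by have := mulr_ge0 (ltW (w0 i)) (z0 i); case: (s i); rewrite /= ?expr0 ?expr1; lra.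
  move=> i; split.
    have := xy (delta_mx 0 i) (or_intror (ex_intro _ i erefl)).
    by rewrite !dot_delta xE mulrAC pmulr_lge0.
  move=> j wji; have ij : i != j by apply: contraTneq wji => ->; rewrite ltxx.
  have := xy (delta_mx 0 i - delta_mx 0 j)
    (or_introl (ex_intro _ i (ex_intro _ j (conj ij (or_introl erefl))))).
  have := xy (delta_mx 0 i + delta_mx 0 j)
    (or_introl (ex_intro _ i (ex_intro _ j (conj ij (or_intror erefl))))).
  rewrite !dot_root !dotDl !dot_delta !xE.
  rewrite -[X in _ -> _ -> is_true X]subr_ge0 -[X in _ -> _ ->
    is_true X](@pmulr_rge0 _ (w i - w j)) ?subr_gt0 //.
  by case: (s i); case: (s j); rewrite /= ?expr0 ?expr1; lra.
rewrite [cones X S]/=; split.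
  move=> /(chamber_fanP _ typeB_complement)[x]; rewrite -typeB_complement.
  move=> [x2 x1] xS; exists (fun i => x 0 i < 0), (fun i => `|x 0 i|).
  have w_inj : injective (fun i => `|x 0 i|).
    move=> i j /eqP; rewrite eqr_norm2; have [//|/x2[ij ij']] := eqVneq i j.
    by rewrite (negPf ij) (negPf ij').
  have w0 i : 0 < `|x 0 i| by rewrite normr_gt0.
  by split=> //; rewrite -(chE _ _ x w_inj w0 (fun i => realEsign (num_real (x 0 i)))).
move=> [s [w [w_inj w0 wS]]]; apply/(chamber_fanP _ typeB_complement).
pose x : 'rV[R]_n := \row_i ((-1) ^+ s i * w i).
have xE i : x 0 i = (-1) ^+ s i * w i by rewrite mxE.
exists x; last by rewrite (chE s w).
rewrite -typeB_complement; split=> [i j ij|i]; rewrite !xE; last first.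
  by rewrite mulf_neq0 ?signr_eq0 // gt_eqF.
have : w i != w j by rewrite (inj_eq w_inj).
have := w0 i; have := w0 j.
by case: (s i); case: (s j); rewrite /= ?expr0 ?expr1 ?mulN1r ?mul1r ?eqr_opp ?opprK
  => wj wi wij; split=> //; lra.
Qed.

(** In a chamber with the signs of [v] whose support comes last in absolute value, the ray is the
    face where absolute values vanish off the support and agree on it. The form [b] sums these
    nonnegative quantities; [v = 0] gives the smallest cone. *)
Lemma PermB_ray v : (forall i, `|v 0 i| <= 1) -> cones X (ray X v).
Proof.
move=> v1; apply/PermB_coneP.
(* Adding [n] puts the support above all other coordinates; the successor keeps the absolute values
   positive. *)
pose s i := v 0 i == -1; pose w (i : 'I_n) : R := (i + (v 0 i != 0)%R * n).+1%:R.
have vE i : (v 0 i)%:~R = (-1) ^+ s i * (v 0 i != 0)%:R :> R.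
  rewrite /s; have : (v 0 i == 0) || (v 0 i == 1) || (v 0 i == -1) by have := v1 i; lia.
  by move=> /orP[/orP[]|] /eqP ->; rewrite /= ?mulr0 ?mulr1 ?expr0 ?expr1.
have wlt i j : (w i < w j) = (i + (v 0 i != 0)%R * n < j + (v 0 j != 0)%R * n)%N.
  by rewrite ltr_nat ltnS.
exists s, w; split=> [i j /eqP|i|]; last 1 first.
- pose pairs := [pred p : 'I_n * 'I_n | (w p.2 < w p.1) && ((v 0 p.1 != 0) && (v 0 p.2 != 0))].
  pose b : 'rV[R]_n := \sum_(i | v 0 i == 0) (-1) ^+ s i *: delta_mx 0 i +
    \sum_(p | pairs p) ((-1) ^+ s p.1 *: delta_mx 0 p.1 - (-1) ^+ s p.2 *: delta_mx 0 p.2).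
  have bE y : dot b y = \sum_(i | v 0 i == 0) (-1) ^+ s i * y 0 i +
      \sum_(p | pairs p) ((-1) ^+ s p.1 * y 0 p.1 - (-1) ^+ s p.2 * y 0 p.2).
    rewrite dotDl !dot_suml; congr (_ + _).
      by apply: eq_bigr => i _; rewrite dotZl dot_delta.
    by apply: eq_bigr => p _; rewrite dotBl !dotZl !dot_delta.
  have b1 y : typeB_chamber s w y -> forall i, v 0 i == 0 -> 0 <= (-1) ^+ s i * y 0 i.
    by move=> xy i _; have [] := xy i.
  have b2 y : typeB_chamber s w y -> forall p, pairs p ->
      0 <= (-1) ^+ s p.1 * y 0 p.1 - (-1) ^+ s p.2 * y 0 p.2.
    by move=> xy p /andP[p21 _]; rewrite subr_ge0; have [_] := xy p.1; apply.
  exists b; split=> [y xy|]; first by rewrite bE addr_ge0 // sumr_ge0 //;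
    [exact: b1 | exact: b2].
  apply/seteqP; split=> y.
    move=> [a [c [a0]]]; rewrite map_mx0 scaler0 addr0 => ->.
    have yE i : (-1) ^+ s i * (a *: vecR R v) 0 i = a * (v 0 i != 0)%:R.
      by rewrite !mxE vE mulrCA signrMK.
    split=> [i|] /=.
      rewrite yE; split=> [|j]; first by rewrite mulr_ge0.
      rewrite wlt yE => wji; rewrite ler_wpM2l // ler_nat.
      by have := ltn_ord i; have := ltn_ord j; move: wji; do 2 case: (_ != _) => //=;
        rewrite ?mul1n ?mul0n; lia.
    rewrite bE !big1 ?addr0 // => [p /andP[_ /andP[p1 p2]]|i vi].
      by rewrite !yE p1 p2 subrr.
    by rewrite yE vi mulr0.
  move=> [xy /= /eqP]; rewrite bE paddr_eq0 ?sumr_ge0 //; [|exact: b1|exact: b2].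
  rewrite !psumr_eq0; [|exact: b2|exact: b1] => /andP[/allP y1 /allP y2].
  have y0 i : v 0 i == 0 -> y 0 i = 0.
    have /implyP/[apply] := y1 i (mem_index_enum i).
    by rewrite mulf_eq0 signr_eq0 /= => /eqP.
  have yeq i j : v 0 i != 0 -> v 0 j != 0 -> (-1) ^+ s i * y 0 i = (-1) ^+ s j * y 0 j.
    move=> vi vj; wlog wji : i j vi vj / w j < w i.
      move=> th; have [/th -> //|/th -> //|] := ltgtP (w j) (w i).
      by rewrite /w vi vj => /eqP; rewrite eqr_nat => /eqP[/addIn/val_inj ->].
    have /implyP := y2 (i, j) (mem_index_enum _).
    by rewrite /= wji vi vj subr_eq0 => /(_ isT) /eqP.
  have [i0 vi0|v0] := pickP [pred i | v 0 i != 0]; last first.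
    exists 0, 0; split=> //; apply/rowP => i; rewrite !mxE !mul0r addr0.
    by apply: y0; have /negbFE := v0 i.
  exists ((-1) ^+ s i0 * y 0 i0), 0; split; first by have [] := xy i0.
  rewrite scale0r addr0; apply/rowP => i; rewrite !mxE vE.
  have [vi|vi] := eqVneq (v 0 i) 0; first by rewrite !mulr0 y0 ?vi.
  by rewrite (yeq i0 i) // mulr1 mulrC signrMK.
- rewrite eqr_nat eqSS => /eqP e; apply/val_inj; move: e.
  have := ltn_ord i; have := ltn_ord j.
  by do 2 case: (_ != _) => //=; rewrite ?mul1n ?mul0n; lia.
- by rewrite ltr0n.
Qed.

Lemma PermB_lin_sub S : cones X S -> ray X 0 `<=` S.
Proof.
move=> /PermB_coneP[s [w [_ _ [b [b0 ->]]]]] y [a [c [_ ->]]].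
rewrite map_mx0 !scaler0 add0r; split=> [i|] /=; last first.
  by rewrite /dot big1 // => i _; rewrite mxE mulr0.
by rewrite mxE mulr0 lexx; split=> // j _; rewrite mxE mulr0.
Qed.

End PermBFan.

Lemma lin0_saturated {R : realType} n (X : toric_fan R n) : lin X = 0 ->
  forall v (b : R), vecR R v = b *: vecR R (lin X) -> exists d, v = d *: lin X.
Proof.
move=> -> v b; rewrite map_mx0 scaler0 => /rowP v0; exists 0; apply/rowP => i.
by have /eqP := v0 i; rewrite !mxE mul0r intr_eq0 => /eqP.
Qed.

Lemma lin0_primitive {R : realType} n (X : toric_fan R n) (v : 'rV[int]_n) i :
  lin X = 0 ->
  `|v 0 i| = 1 -> primitive X v.
Proof.
move=> X0 vi c d w; rewrite X0 scaler0 addr0 => /rowP/(_ i).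
rewrite mxE => e; apply: (@intM_norm_eq1 _ (w 0 i)); by rewrite -e.
Qed.

(** * Rays of normal fans and the stellahedral fan *)

Section NormalFan.
Context {R : realType} {n : nat}.
Implicit Types (P S : set 'rV[R]_n) (a b x : 'rV[R]_n) (v : 'rV[int]_n).

Lemma closure_halfspace S b x : (forall z, S z -> 0 <= dot b z) -> closure S x ->
  0 <= dot b x.
Proof.
move=> Sb Sx; have : [set z | 0 <= dot b z] x; last by [].
by apply: (closed_halfspace (a := b)); apply: closure_subset Sx => z /Sb.
Qed.

(** The bipolar theorem for a half-line. With [v 0 i] nonzero, the forms v_i e_j - v_j e_i give
    proportionality and v_i e_i gives the sign. *)
Lemma halfline_dual v x :
  (forall b, 0 <= dot b (vecR R v) -> 0 <= dot b x) ->
  exists2 c, 0 <= c & x = c *: vecR R v.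
Proof.
move=> dual.
have dual0 b : dot b (vecR R v) = 0 -> dot b x = 0.
  move=> b0; apply/le_anti; rewrite dual ?b0 // andbT -oppr_ge0 -dotNl.
  by rewrite dual // dotNl b0 oppr0.
have [i vi|v0] := pickP [pred i | v 0 i != 0]; last first.
  exists 0 => //; apply/rowP => i; rewrite scale0r [RHS]mxE -dot_delta.
  by rewrite dual0 // dot_delta mxE; have /negbFE/eqP -> := v0 i.
have vi' : (v 0 i)%:~R != 0 :> R by rewrite intr_eq0.
exists (x 0 i / (v 0 i)%:~R); last first.
  apply/rowP => j; apply: (mulfI vi').
  have : dot ((v 0 i)%:~R *: delta_mx 0 j - (v 0 j)%:~R *: delta_mx 0 i) x = 0.
    apply: dual0; rewrite dotBl !dotZl !dot_delta !mxE; ring.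
  rewrite dotBl !dotZl !dot_delta !mxE => /eqP; rewrite subr_eq0 => /eqP ->.
  by field.
have := dual ((v 0 i)%:~R *: delta_mx 0 i).
rewrite !dotZl !dot_delta mxE -expr2 sqr_ge0 => /(_ isT).
have -> : x 0 i / (v 0 i)%:~R = (v 0 i)%:~R * x 0 i / (v 0 i)%:~R ^+ 2 by field.
by move=> ?; rewrite divr_ge0 // sqr_ge0.
Qed.

Lemma polytope_face_scale P a c : 0 < c ->
  polytope_face P (c *: a) = polytope_face P a.
Proof.
move=> c0; apply/seteqP; split=> x [Px xmax]; split=> // y Py;
  by have := xmax y Py; rewrite !dotZl ler_pM2l.
Qed.

Lemma normal_cone_lin_sub P S : normal_fan P S -> S 0.
Proof.
move=> [b _ <-]; apply: (@closure_line _ _ _ _ b) => t t0.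
by rewrite add0r /= polytope_face_scale.
Qed.

(** It suffices to bound the relatively open normal cone: half-lines are closed, and positive
    multiples of [vecR R v] select the same face. *)
Lemma normal_cone_halfline P v :
  (forall a, polytope_face P a = polytope_face P (vecR R v) ->
     exists2 c, 0 <= c & a = c *: vecR R v) ->
  normal_fan P [set c *: vecR R v | c in [set c | 0 <= c]].
Proof.
move=> Pv; exists (vecR R v) => //; apply/seteqP; split=> x.
  move=> Sx; have [b bv|c c0 ->] := @halfline_dual v x; last by exists c.
  apply: closure_halfspace Sx => z /Pv[c c0 ->].
  by rewrite dotZr mulr_ge0.
move=> [c c0 <-]; apply: (@closure_line _ _ _ _ (vecR R v)) => t t0.
by rewrite -scalerDl /= polytope_face_scale // ltr_wpDl.
Qed.

Lemma polytope_face_eq P a x y : polytope_face P a x -> polytope_face P a y ->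
  dot a x = dot a y.
Proof. by move=> [Px xmax] [Py ymax]; apply/le_anti; rewrite ymax ?xmax. Qed.

End NormalFan.

Section StellFan.
Context {R : realType} {n : nat}.
Implicit Types (A : {set 'I_n}) (g : {perm 'I_n}) (x a : 'rV[R]_n).
Local Notation X := (Stell R n).
Local Notation P := (@stellahedron R n).

Lemma stell_box g x : (forall i, 0 <= x 0 i <= (g i).+1%:R) -> P x.
Proof.
move=> xg; split=> [i|]; first by case/andP: (xg i).
exists (\row_i (g i).+1%:R); first by apply: sub_conv; exists g.
by move=> i; rewrite mxE; case/andP: (xg i).
Qed.

Lemma stell_dot_le A c :
  (forall g, \sum_(i in A) ((g i).+1%:R : R) <= c) ->
  forall x, P x -> dot (evec A) x <= c.
Proof.
move=> gc x [x0 [y py xy]]; apply: (@le_trans _ _ (dot (evec A) y)).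
  by apply: ler_sum => i _; rewrite ler_wpM2l // mxE; case: (i \in A).
rewrite dotC; apply: conv_dot_le py => _ [g _ <-].
apply: le_trans (gc g); rewrite [leRHS]big_mkcond; apply: ler_sum => i _.
by rewrite !mxE; case: (i \in A); rewrite ?mulr1 ?mulr0.
Qed.

Lemma stell0 : P 0.
Proof. by apply: (@stell_box 1%g) => i; rewrite mxE lexx ler0n. Qed.

Lemma stell_delta i : P (delta_mx 0 i).
Proof.
apply: (@stell_box 1%g) => j; rewrite mxE eqxx /=.
by case: (j == i); rewrite ?ler01 ?lexx ?ler0n // ler1n.
Qed.

Lemma Stell_rayE v : ray X v = [set c *: vecR R v | c in [set c | 0 <= c]].
Proof.
apply/seteqP; split=> x.
  by move=> [c [d [c0 ->]]]; exists c => //; rewrite map_mx0 scaler0 addr0.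
by move=> [c c0 <-]; exists c, 0; rewrite scale0r addr0.
Qed.

Lemma Stell_lin_sub S : cones X S -> ray X 0 `<=` S.
Proof.
move=> /normal_cone_lin_sub S0; rewrite Stell_rayE => _ [c _ <-].
by rewrite map_mx0 scaler0.
Qed.

(** The face x_i = 0 contains the origin and the other unit vectors, which leaves only the
    coordinate [a 0 i]; comparison with the unit vector at [i] gives its sign. *)
Lemma Stell_ray_coord i : cones X (ray X (- ivec [set i]%SET)).
Proof.
rewrite Stell_rayE; apply: normal_cone_halfline => a aE.
have vE x : dot (vecR R (- ivec [set i]%SET)) x = - x 0 i.
  rewrite -dot_delta -dotNl; congr dot; apply/rowP => j.
  by rewrite !mxE inE rmorphN /= rmorph_nat; case: (j == i).
have [a0 ai] : polytope_face P a 0 /\ forall j, j != i -> polytope_face P a (delta_mx 0 j).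
  rewrite aE; split=> [|j ji]; (split; first by [exact: stell0 | exact: stell_delta]);
    move=> y [y0 _]; rewrite !vE !mxE ?oppr0 ?oppr_le0 //.
  by rewrite eq_sym (negPf ji) oppr0 oppr_le0.
have dot0 x : dot x (0 : 'rV[R]_n) = 0 by rewrite /dot big1 // => j _; rewrite mxE mulr0.
exists (- a 0 i).
  by have [_ /(_ _ (stell_delta i))] := a0; rewrite dot0 dotC dot_delta oppr_ge0.
apply/rowP => j; rewrite !mxE inE rmorphN /= rmorph_nat mulrNN.
have [->|ji] := eqVneq j i; first by rewrite mulr1.
by rewrite mulr0 -dot_delta dotC (polytope_face_eq (ai j ji) a0) dot0.
Qed.

(** The empty [A] is included and yields the zero cone. *)
Lemma Stell_ray_set A : cones X (ray X (ivec A)).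
Proof.
rewrite Stell_rayE; apply: normal_cone_halfline => a; rewrite vecR_ivec => aE.
have dot0 x : dot x (0 : 'rV[R]_n) = 0 by rewrite /dot big1 // => j _; rewrite mxE mulr0.
pose y g : 'rV[R]_n := \row_i ((i \in A)%:R * (g i).+1%:R).
pose h g : R := \sum_(i in A) (g i).+1%:R.
(* A vertex of the face is given by any [g] maximizing the sum over [A]; moving
   along the coordinates off [A], or transposing two elements of [A], stays in
   the face, which forces [a] to be a multiple of the indicator of [A]. *)
have [g _ gmax] := Order.TotalTheory.arg_maxP h (isT : predT (1%g : {perm 'I_n})).
have yE g' : dot (evec A) (y g') = h g'.
  rewrite /h [RHS]big_mkcond; apply: eq_bigr => i _; rewrite !mxE.
  by case: (i \in A); rewrite ?mul1r ?mul0r.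
have face x : P x -> dot (evec A) x = h g -> polytope_face P a x.
  move=> Px xg; rewrite aE; split=> // z Pz; rewrite xg; apply: stell_dot_le Pz => g'.
  exact: gmax.
have yface g' : h g' = h g -> polytope_face P a (y g').
  move=> g'g; apply: face; last by rewrite yE.
  apply: (@stell_box g') => i; rewrite mxE.
  by case: (i \in A); rewrite ?mul1r ?mul0r ?ler0n ?lexx.
have a_out j : j \notin A -> a 0 j = 0.
  move=> jA; have fj : polytope_face P a (y g + delta_mx 0 j).
    apply: face; last first.
      by rewrite dotDr yE [dot _ (delta_mx _ _)]dotC dot_delta mxE (negPf jA) addr0.
    apply: (@stell_box g) => i; rewrite !mxE eqxx /=.
    have [->|_] := eqVneq i j; first by rewrite (negPf jA) mul0r add0r ler01 ler1n.
    by rewrite addr0; case: (i \in A); rewrite ?mul1r ?mul0r ?ler0n ?lexx.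
  have := polytope_face_eq fj (yface g erefl).
  by rewrite dotDr [dot a (delta_mx _ _)]dotC dot_delta => /eqP;
    rewrite addrC -subr_eq0 addrK => /eqP.
have a_in i j : i \in A -> j \in A -> a 0 i = a 0 j.
  move=> iA jA; have [->//|ij] := eqVneq i j.
  pose g' := (tperm i j * g)%g.
  have g'g : h g' = h g.
    rewrite /h [RHS](reindex_inj (@perm_inj _ (tperm i j))) /=.
    apply: eq_big => k; last by rewrite permM.
    by case: tpermP => [->|->|]; rewrite ?iA ?jA.
  have := polytope_face_eq (yface g' g'g) (yface g erefl).
  have -> : y g' = y g + ((g j)%:R - (g i)%:R) *: (delta_mx 0 i - delta_mx 0 j).
    apply/rowP => k; rewrite !mxE permM eqxx /=.
    case: tpermP => [->|->|/eqP/negPf-> /eqP/negPf->].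
    - by rewrite iA eqxx (negPf ij) !mul1r subr0 mulr1 -natr1 -[in RHS]natr1; ring.
    - by rewrite jA eqxx eq_sym (negPf ij) !mul1r sub0r mulr1n -natr1 -[in RHS]natr1; ring.
    - by rewrite subrr mulr0 addr0.
  rewrite dotDr dotZr [dot a (_ - _)]dotC dot_root => /eqP.
  rewrite addrC -subr_eq0 addrK mulf_eq0 !subr_eq0 eqr_nat => /orP[/eqP gij|/eqP //].
  by have /perm_inj ji := val_inj gij; rewrite ji eqxx in ij.
have [i0 i0A|A0] := pickP (mem A); last first.
  exists 0 => //; apply/rowP => j; rewrite scale0r [RHS]mxE a_out //.
  by have := A0 j => /= ->.
have aA : a = a 0 i0 *: evec A.
  apply/rowP => j; rewrite !mxE; case: (boolP (j \in A)) => jA.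
    by rewrite mulr1; apply: a_in.
  by rewrite mulr0 a_out.
exists (a 0 i0) => //.
(* Comparing the vertex with the origin gives the sign of the multiple, as [h g] is positive for
   nonempty [A]. *)
have [_ /(_ _ stell0)] := yface g erefl.
rewrite dot0 {1}aA dotZl yE pmulr_lge0 //.
rewrite /h (bigD1 i0) //=; apply: ltr_pwDl; first by rewrite ltr0n.
by apply: sumr_ge0 => i _; rewrite ler0n.
Qed.

End StellFan.

(** * Lattice points cut out by the rays *)

Lemma ivec0 n : ivec finset.set0 = 0 :> 'rV[int]_n.
Proof. by apply/rowP => i; rewrite !mxE inE. Qed.

Section CutByRays.
Context {R : realType} {n : nat}.
Implicit Types (F : {set {set 'I_n}}) (t z : 'rV[int]_n) (A B : {set 'I_n}).

Lemma dot_ivec_ivec A B : dot (ivec B) (ivec A) = \sum_(i in A) (i \in B)%:R.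
Proof. by rewrite dot_ivec; apply: eq_bigr => i _; rewrite mxE. Qed.

Lemma ivec_of_range z : (forall i, 0 <= z 0 i <= 1) -> exists B, z = ivec B.
Proof.
move=> z01; exists [set i | z 0 i == 1]%SET; apply/rowP => i.
by rewrite mxE inE; have := z01 i; case: eqP; lia.
Qed.

(** The two sides count the elements of [A] and those of its intersection with [B]. *)
Lemma dot_ivec_sub A B : dot (ivec A) (ivec A) <= dot (ivec B) (ivec A) -> A \subset B.
Proof.
rewrite !dot_ivec_ivec -subr_ge0 -sumrB => h; apply/fintype.subsetP => i iA.
apply: contraLR h => iB; rewrite -ltNge (bigD1 i) //= iA (negPf iB).
apply: (@le_lt_trans _ _ (-1)); last by [].
rewrite -[leRHS]addr0 lerD //; apply: sumr_le0 => j /andP[jA _].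
by rewrite jA; case: (j \in B).
Qed.

(** Being a character fixes the coordinate sum. Singletons bound each coordinate by 1, and
    complements of singletons, with the fixed sum, by 0 from below. If then [z] is the indicator of
    [B'], the ray of [B'] puts it inside a member of [F] of the same size. *)
Lemma Perm_cut_by_rays F t : (0 < n)%N -> F != finset.set0 ->
  (forall B, B \in F -> charM (Perm R n) (ivec B + t)) -> cut_by_rays (Perm R n) F t.
Proof.
move=> n_gt0 /set0Pn[B0 FB0] Ft z Mz zF.
have oneE : const_mx 1 = ivec [set: 'I_n]%SET by apply/rowP => i; rewrite !mxE inE.
have sumB B : B \in F -> dot z (ivec [set: 'I_n]%SET) = dot (ivec B) (ivec [set: 'I_n]%SET).
  move=> FB; rewrite -oneE; apply: (addIr (dot t (const_mx 1))); rewrite -!dotDl.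
  by have := Ft B FB; rewrite /charM /= => ->.
have key A : exists2 B, B \in F & dot z (ivec A) <= dot (ivec B) (ivec A).
  have [->|A0] := eqVneq A finset.set0.
    by exists B0 => //; rewrite !dot_ivec !big_set0.
  have [->|AT] := eqVneq A [set: 'I_n]%SET.
    by exists B0 => //; rewrite (sumB B0).
  by apply: zF; [exact: Perm_primitive | exact: Perm_ray].
have [|B' zB'] := @ivec_of_range z.
  move=> i; apply/andP; split; last first.
    have [B _] := key [set i]%SET; rewrite dot_ivec_ivec dot_ivec !big_set1.
    by case: (i \in B) => /=; lia.
  have [B FB] := key (~: [set i])%SET.
  have := sumB B FB; rewrite !dot_ivec_ivec !dot_ivec.
  rewrite (bigD1 i) ?inE //= [in RHS](bigD1 i) ?inE //=.
  have E (f : 'I_n -> int) : \sum_(j in (~: [set i])%SET) f j =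
    \sum_(j | (j \in [set: 'I_n]%SET) && (j != i)) f j.
    by apply: eq_bigl => j; rewrite !inE.
  rewrite !E; set a := \sum_(_ | _) z 0 _; set b := \sum_(_ | _) _.
  by have : 0 <= ((i \in B)%:R : int) by []; lia.
have [B FB] := key B'; rewrite zB' => /dot_ivec_sub B'B.
exists B => //; congr ivec; apply/eqP; rewrite finset.eqEsubset B'B /=.
apply: dot_ivec_sub; have := sumB B FB; rewrite zB' !dot_ivec_ivec => e.
have cardE (A C : {set 'I_n}) : A \subset C ->
  \sum_(i in C) (i \in A)%:R = \sum_(i in [set: 'I_n]%SET) (i \in A)%:R :> int.
  move=> /fintype.subsetP AC; rewrite big_mkcond [RHS]big_mkcond; apply: eq_bigr => i _.
  by rewrite inE; case: (boolP (i \in A)) => [/AC ->|]; rewrite ?if_same.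
by rewrite (cardE B) // (cardE B') // e.
Qed.

(** The rays -e_i and e_i confine [z] to the cube; the ray of the resulting set [B'] puts it inside
    a member of [F], and [F] is closed under subsets. *)
Lemma Stell_cut_by_rays F t : F != finset.set0 -> (forall A B, A \subset B -> B \in F ->
  A \in F) ->
  cut_by_rays (Stell R n) F t.
Proof.
move=> /set0Pn[B0 FB0] F_sub z _ zF.
have key A : A != finset.set0 -> exists2 B,
  B \in F & dot z (ivec A) <= dot (ivec B) (ivec A).
  move=> /set0Pn[i iA]; apply: zF; last exact: Stell_ray_set.
  by apply: (@lin0_primitive _ _ _ _ i) => //; rewrite mxE iA.
have [|B' zB'] := @ivec_of_range z.
  move=> i; apply/andP; split.
    have [||B _] := zF (- ivec [set i]%SET).
    - by apply: (@lin0_primitive _ _ _ _ i) => //; rewrite !mxE inE eqxx.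
    - exact: Stell_ray_coord.
    rewrite ![dot _ (- _)]dotC !dotNl ![dot (ivec [set i]%SET) _]dotC.
    rewrite dot_ivec_ivec dot_ivec !big_set1.
    by case: (i \in B) => /=; lia.
  have [|B _] := key [set i]%SET; first by apply/set0Pn; exists i; rewrite inE.
  rewrite dot_ivec_ivec dot_ivec !big_set1.
  by case: (i \in B) => /=; lia.
exists B' => //; have [B'0|/key[B FB]] := eqVneq B' finset.set0.
  by rewrite B'0; apply: F_sub FB0; rewrite finset.sub0set.
by rewrite zB' => /dot_ivec_sub /F_sub; apply.
Qed.

(** After the rays e_i and -e_i confine [z] to the cube, the ray with entry 1 on [B'] and -1 off it
    is used: over the cube it is maximal at the vertex [B'] alone. *)
Lemma PermB_cut_by_rays F t : (0 < n)%N -> cut_by_rays (PermB R n) F t.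
Proof.
move=> n_gt0 z _ zF.
have key (v : 'rV[int]_n) : (forall i, `|v 0 i| <= 1) -> (exists i, `|v 0 i| = 1) ->
    exists2 B, B \in F & dot z v <= dot (ivec B) v.
  move=> v1 [i vi]; apply: zF; last exact: PermB_ray.
  exact: (@lin0_primitive _ _ _ _ i).
have [|B' zB'] := @ivec_of_range z.
  move=> i; apply/andP; split.
    have [||B _] := key (- ivec [set i]%SET).
    - by move=> j; rewrite !mxE; case: (_ \in _).
    - by exists i; rewrite !mxE inE eqxx.
    rewrite ![dot _ (- _)]dotC !dotNl ![dot (ivec [set i]%SET) _]dotC.
    rewrite dot_ivec_ivec dot_ivec !big_set1.
    by case: (i \in B) => /=; lia.
  have [||B _] := key (ivec [set i]%SET).
  - by move=> j; rewrite !mxE; case: (_ \in _).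
  - by exists i; rewrite !mxE inE eqxx.
  rewrite dot_ivec_ivec dot_ivec !big_set1.
  by case: (i \in B) => /=; lia.
pose v := \row_i (if i \in B' then 1 else -1 : int).
have [||B FB] := key v.
- by move=> j; rewrite mxE; case: (_ \in _).
- by exists (Ordinal n_gt0); rewrite mxE; case: (_ \in _).
move=> zB; exists B => //; rewrite zB'; congr ivec; apply/setP => i.
apply: contraTeq zB => iBB; rewrite -ltNge -subr_gt0 -dotBl zB'.
rewrite /dot (bigD1 i) //= ltr_pwDl //.
  by rewrite !mxE; move: iBB; case: (i \in B); case: (i \in B').
by apply: sumr_ge0 => j _; rewrite !mxE; case: (j \in B); case: (j \in B').
Qed.

End CutByRays.

(** * Exchanging loops and coloops *)

Section Twist.
Variable n : nat.
Implicit Types (F : {set {set 'I_n}}) (A B C S T : {set 'I_n}).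

Lemma in_symdiff A B i : (i \in symdiff A B) = (i \in A) (+) (i \in B).
Proof. by rewrite !inE; case: (i \in A); case: (i \in B). Qed.

Lemma symdiffK A B : symdiff (symdiff A B) B = A.
Proof. by apply/setP => i; rewrite !in_symdiff -addbA addbb addbF. Qed.

(** The twist known from delta matroids. Twisting by all coloops removes them from every set, and
    twisting by all loops adds them to every set. *)
Definition twist F C : {set {set 'I_n}} := [set symdiff B C | B in F]%SET.

Lemma in_twist F C B : (B \in twist F C) = (symdiff B C \in F).
Proof.
apply/imsetP/idP => [[A FA ->]|FB]; first by rewrite symdiffK.
by exists (symdiff B C); rewrite ?symdiffK.
Qed.

Lemma twist_symdiff F C B : B \in F -> symdiff B C \in twist F C.
Proof. by rewrite in_twist symdiffK. Qed.

Lemma twistK F C : twist (twist F C) C = F.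
Proof. by apply/setP => B; rewrite !in_twist symdiffK. Qed.

Lemma twist_neq0 F C : F != finset.set0 -> twist F C != finset.set0.
Proof. by move=> /set0Pn[B FB]; apply/set0Pn; exists (symdiff B C);
  apply: twist_symdiff. Qed.

Lemma loopsP F i : reflect (forall B, B \in F -> i \notin B) (i \in loops F).
Proof. by rewrite inE; apply: forall_inP. Qed.

Lemma coloopsP F i : reflect (forall B, B \in F -> i \in B) (i \in coloops F).
Proof. by rewrite inE; apply: forall_inP. Qed.

Lemma coloopless_twist F : F != finset.set0 -> coloopless (twist F (coloops F)).
Proof.
move=> /set0Pn[B0 FB0]; apply/eqP/setP => i; rewrite finset.in_set0;
  apply/negP => /coloopsP h.
have {}h B : B \in F -> (i \in B) != (i \in coloops F).
  by move=> /(twist_symdiff (coloops F))/h; rewrite in_symdiff negb_eqb.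
have iF : i \in coloops F by apply/negPn/negP => iF; case/coloopsP: (iF) => B /h;
  rewrite (negPf iF); case: (i \in B).
by have := h _ FB0; rewrite iF; have /coloopsP -> := iF.
Qed.

Lemma loopless_twist F : F != finset.set0 -> loopless (twist F (loops F)).
Proof.
move=> /set0Pn[B0 FB0]; apply/eqP/setP => i; rewrite finset.in_set0;
  apply/negP => /loopsP h.
have {}h B : B \in F -> (i \in B) = (i \in loops F).
  by move=> /(twist_symdiff (loops F))/h; rewrite in_symdiff; case: (i \in B);
    case: (i \in loops F).
have iF : i \in loops F by apply/negPn/negP => iF; case/loopsP: (iF) => B /h;
  rewrite (negPf iF) => ->.
by have := h _ FB0; rewrite iF => iB; have /loopsP/(_ _ FB0) := iF; rewrite iB.
Qed.

(** As there were no loops before, the loops after twisting are exactly the old coloops; twisting by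
    them undoes the first twist. *)
Lemma loops_twist F : loopless F -> loops (twist F (coloops F)) = coloops F.
Proof.
move=> /eqP F0; apply/setP => i; apply/loopsP/idP => [h|iF B]; last first.
  by rewrite in_twist => FB; have /coloopsP/(_ _ FB) := iF; rewrite in_symdiff iF;
    case: (i \in B).
apply: contraT => iF; have : i \in loops F; last by rewrite F0 finset.in_set0.
apply/loopsP => B /(twist_symdiff (coloops F))/h.
by rewrite in_symdiff (negPf iF) addbF.
Qed.

Lemma coloops_twist F : coloopless F -> coloops (twist F (loops F)) = loops F.
Proof.
move=> /eqP F0; apply/setP => i; apply/coloopsP/idP => [h|iF B]; last first.
  by rewrite in_twist => FB; have /loopsP/(_ _ FB) := iF; rewrite in_symdiff iF;
    case: (i \in B).
apply: contraT => iF; have : i \in coloops F; last by rewrite F0 finset.in_set0.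
apply/coloopsP => B /(twist_symdiff (loops F))/h.
by rewrite in_symdiff (negPf iF) addbF.
Qed.

(** Twisting does not change symmetric differences of two members, so the same [f] serves in the
    exchange. *)
Lemma delta_twist F C : delta_axiom F -> delta_axiom (twist F C).
Proof.
move=> /andP[F0 /forall_inP ex]; rewrite /delta_axiom twist_neq0 //=.
apply/forall_inP => A1 A1F; apply/forall_inP => A2 A2F; rewrite !in_twist in A1F A2F.
have E : symdiff (symdiff A1 C) (symdiff A2 C) = symdiff A1 A2.
  by apply/setP => i; rewrite !in_symdiff addbACA addbb addbF.
have /forall_inP/(_ _ A2F) := ex _ A1F; rewrite E => /forall_inP {}ex.
apply/forall_inP => e /ex /exists_inP[f fA A1ef]; apply/exists_inP; exists f => //.
rewrite in_twist (_ : symdiff _ C = symdiff (symdiff A1 C) [set e; f]%SET) //.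
by apply/setP => i; rewrite !in_symdiff addbAC.
Qed.

(** Membership of an element of [C] is the same in all bases, so exchanges never involve [C]. *)
Lemma matroid_twist F C : C \subset (loops F :|: coloops F)%SET ->
  matroid_axiom F -> matroid_axiom (twist F C).
Proof.
move=> /fintype.subsetP CF /andP[F0 /forall_inP ex]; rewrite /matroid_axiom twist_neq0 //=.
have const i A B : i \in C -> A \in F -> B \in F -> (i \in A) = (i \in B).
  move=> /CF + FA FB; rewrite finset.in_setU => /orP[/loopsP h|/coloopsP h].
    by rewrite (negPf (h _ FA)) (negPf (h _ FB)).
  by rewrite !h.
apply/forall_inP => A1 A1F; apply/forall_inP => A2 A2F; rewrite !in_twist in A1F A2F.
have E B1 B2 i : symdiff B1 C \in F -> symdiff B2 C \in F ->
    (i \in B1 :\: B2)%SET -> i \notin C.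
  move=> FB1 FB2; rewrite finset.in_setD => /andP[i2 i1]; apply/negP => iC.
  by have := const i _ _ iC FB1 FB2; rewrite !in_symdiff iC i1 (negPf i2).
have ED B1 B2 i : i \notin C -> (i \in B1 :\: B2)%SET =
  (i \in symdiff B1 C :\: symdiff B2 C)%SET.
  by move=> /negPf iC; rewrite !finset.in_setD !in_symdiff iC !addbF.
apply/forall_inP => x xA; have xC := E _ _ _ A1F A2F xA.
have /forall_inP/(_ _ A2F)/forall_inP/(_ x) := ex _ A1F.
rewrite -ED // => /(_ xA)/exists_inP[y yA yF]; apply/exists_inP; exists y.
  rewrite ED //; apply/negP => yC; move: yA.
  by rewrite finset.in_setD (const y _ _ yC A2F A1F); case: (y \in _).
have yC : y \notin C.
  apply/negP => yC; move: yA.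
  by rewrite finset.in_setD (const y _ _ yC A2F A1F); case: (y \in _).
rewrite in_twist (_ : symdiff _ C = (y |: (symdiff A1 C :\ x))%SET) //.
apply/setP => i; rewrite in_symdiff !finset.in_setU1 !finset.in_setD1 in_symdiff.
have [->|_] := eqVneq i y; first by rewrite (negPf yC).
have [->|_] //= := eqVneq i x; first by rewrite (negPf xC).
Qed.

End Twist.

(** * The Gale order and Schubert matroids *)

Section Gale.
Variable n : nat.
Implicit Types (w : {perm 'I_n}) (C D S T : {set 'I_n}).

(** Entrywise comparison of sorted lists is traded for counts on down-closed sets. The heads are
    compared by testing with the elements below [b]. *)
Lemma all2_sortedP (U : eqType) (r : rel U) (s t : seq U) :
  transitive r -> reflexive r -> sorted r s -> sorted r t ->
  all2 r s t <-> size s = size t /\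
    forall D : pred U, (forall a b, r a b -> D b -> D a) -> (count D t <= count D s)%N.
Proof.
move=> r_trans r_refl; elim: s t => [|a s IHs] [|b t] //=.
- by move=> _ _; split; [by [] | case=> /eqP].
- by move=> _ _; split; [by [] | case=> /eqP].
move=> /[dup] pas /path_sorted ss /[dup] pbt /path_sorted st.
have {IHs} IHs := IHs t ss st.
have amin : forall c, c \in s -> r a c by apply/allP; apply: order_path_min pas.
have bmin : forall c, c \in t -> r b c by apply/allP; apply: order_path_min pbt.
split=> [/andP[ab /IHs[-> cnt]]|[[sz] cnt]].
  split=> // D Dd; apply: leq_add; last exact: cnt.
  by case: (boolP (D b)) => // /(Dd _ _ ab) ->.
have ab : r a b.
  have : (0 < (r a b) + count (r^~ b) s)%N.
    apply: leq_trans (cnt (r^~ b) (fun x y xy yb => r_trans _ _ _ xy yb)).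
    by rewrite r_refl.
  rewrite addn_gt0 => /orP[|]; first by case: (r a b).
  by rewrite -has_count => /hasP[c /amin ac cb]; apply: r_trans cb.
rewrite ab /=; apply/IHs; split=> // D Dd.
have := cnt D Dd; case: (boolP (D b)) => [/(Dd _ _ ab) ->|Db _]; first by rewrite leq_add2l.
(* As [b] is minimal in [t] and lies off the down-closed [D], no entry of [t] lies in [D]. *)
rewrite (_ : count D t = 0)%N //; apply/eqP; rewrite -leqn0 leqNgt -has_count.
by apply/hasPn => c /bmin bc; apply: contra Db; apply: Dd.
Qed.

Definition downset w D := forall i j, le_perm w i j -> j \in D -> i \in D.

Lemma le_perm_trans w : transitive (le_perm w).
Proof. by move=> j i k; apply: leq_trans. Qed.

Lemma le_perm_refl w : reflexive (le_perm w).
Proof. by move=> i; apply: leqnn. Qed.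

Lemma le_perm_total w : total (le_perm w).
Proof. by move=> i j; apply: leq_total. Qed.

Lemma galeP w S T : gale w S T <->
  #|S| = #|T| /\ forall D, downset w D -> (#|T :&: D| <= #|S :&: D|)%N.
Proof.
have sortedS (A : {set 'I_n}) : sorted (le_perm w) (sort (le_perm w) (enum A)).
  by apply: sort_sorted; apply: le_perm_total.
have countE (A : {set 'I_n}) (D : pred 'I_n) :
    count D (sort (le_perm w) (enum A)) = #|A :&: [set i | D i]|%SET.
  rewrite (seq.permP (permEl (perm_sort _ _))) cardE -size_filter.
  apply/perm_size/uniq_perm => [||i];
    [by rewrite filter_uniq // enum_uniq | exact: enum_uniq |].
  by rewrite mem_filter !mem_enum !inE andbC.
rewrite /gale all2_sortedP //; [|exact: le_perm_trans|exact: le_perm_refl].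
rewrite !size_sort -!cardE; split=> -[sz cnt]; split=> // D Dd.
  have := cnt (mem D) Dd; rewrite !countE.
  by rewrite (_ : [set i | mem D i]%SET = D) //; apply/setP => i; rewrite inE.
by rewrite !countE; apply: cnt => i j ij; rewrite !inE; apply: Dd.
Qed.

Lemma gale_refl w S : gale w S S.
Proof. by apply/galeP. Qed.

(** A downset that contains [j] contains [i], so the exchange cannot increase the count on any
    downset. *)
Lemma gale_exchange w S T i j : gale w S T -> i \in T -> j \notin T -> le_perm w i j ->
  gale w S (j |: (T :\ i))%SET.
Proof.
move=> /galeP[ST cnt] iT jT ij; apply/galeP.
have jTi : j \notin (T :\ i)%SET by rewrite finset.in_setD1 (negPf jT) andbF.
split=> [|D Dd]; first by rewrite finset.cardsU1 jTi ST (finset.cardsD1 i) iT.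
apply: leq_trans (cnt D Dd).
have -> : ((j |: T :\ i) :&: D = (if j \in D then [set j] else finset.set0) :|:
  ((T :&: D) :\ i))%SET.
  apply/setP => k; rewrite !inE; case: ifP => jD; rewrite !inE.
    by have [->|_] := eqVneq k j; rewrite ?jD //= andbA.
  by have [->|_] := eqVneq k j; rewrite ?jD ?(negPf jT) /= ?andbF // andbA.
rewrite finset.cardsU (_ : (_ :&: ((T :&: D) :\ i))%SET =
  finset.set0) ?finset.cards0 ?subn0; last first.
  apply/setP => k; rewrite !inE; case: ifP => _; rewrite !inE //.
  by have [->|] := eqVneq k j; rewrite ?(negPf jT) ?andbF.
rewrite [X in (_ <= X)%N](finset.cardsD1 i) leq_add2r !inE iT.
by case: ifP => [/(Dd _ _ ij) ->|]; rewrite ?finset.cards1 ?finset.cards0.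
Qed.

(** Ranks with respect to an injective key form a permutation; its inverse is taken because
    [le_perm] compares positions under [w^-1]. *)
Lemma perm_of_rank (f : 'I_n -> nat) : injective f ->
  exists w, forall i j, le_perm w i j = (f i <= f j)%N.
Proof.
move=> f_inj; pose rk i := #|[set j | f j < f i]%N|%SET.
have rk_lt i : (rk i < n)%N.
  rewrite -[X in (_ < X)%N](card_ord n) -finset.cardsT; apply: proper_card.
  by rewrite finset.properT; apply/eqP => /setP/(_ i); rewrite !inE ltnn.
have rk_mono i j : (f i < f j)%N -> (rk i < rk j)%N.
  move=> ij; apply: proper_card; apply/properP; split; last by exists i; rewrite inE ?ltnn.
  by apply/fintype.subsetP => k; rewrite !inE => /ltn_trans; apply.
have rkE i j : (rk i <= rk j)%N = (f i <= f j)%N.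
  case: (ltngtP (f i) (f j)) => [/rk_mono/ltnW //|/rk_mono|/f_inj ->];
    last by rewrite leqnn.
  by rewrite ltnNge => /negPf.
pose u i := Ordinal (rk_lt i).
have u_inj : injective u.
  by move=> i j /(congr1 val) /= e; apply: f_inj; apply/eqP; rewrite eqn_leq -!rkE e leqnn.
by exists (perm u_inj)^-1%g => i j; rewrite /le_perm invgK !permE; apply: rkE.
Qed.

Lemma le_perm_lower w C : exists w',
  (forall i j, i \notin C -> j \notin C -> le_perm w' i j = le_perm w i j) /\
  (forall i j, i \in C -> j \notin C -> le_perm w' j i = false).
Proof.
(* Positions are below [n], so adding [n] off [C] moves [C] to the front and keeps the rest in
   order. *)
pose f i := ((w^-1)%g i + (i \notin C) * n)%N.
have [|w' w'E] := @perm_of_rank f.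
  move=> i j; rewrite /f; have := ltn_ord ((w^-1)%g i); have := ltn_ord ((w^-1)%g j).
  move=> h1 h2 e; apply: (@perm_inj _ w^-1%g); apply: val_inj; move: h1 h2 e => /=.
  by case: (i \in C); case: (j \in C) => /=; rewrite ?mul1n ?mul0n; lia.
exists w'; split=> i j iC jC; rewrite w'E /f /le_perm.
  by rewrite iC jC leq_add2r.
rewrite iC jC mul1n mul0n; apply/negP.
by have := ltn_ord ((w^-1)%g i); have := ltn_ord ((w^-1)%g j); lia.
Qed.

Lemma le_perm_upper w C : exists w',
  (forall i j, i \notin C -> j \notin C -> le_perm w' i j = le_perm w i j) /\
  (forall i j, i \in C -> j \notin C -> le_perm w' i j = false).
Proof.
pose f i := ((w^-1)%g i + (i \in C) * n)%N.
have [|w' w'E] := @perm_of_rank f.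
  move=> i j; rewrite /f; have := ltn_ord ((w^-1)%g i); have := ltn_ord ((w^-1)%g j).
  move=> h1 h2 e; apply: (@perm_inj _ w^-1%g); apply: val_inj; move: h1 h2 e => /=.
  by case: (i \in C); case: (j \in C) => /=; rewrite ?mul1n ?mul0n; lia.
exists w'; split=> i j iC jC; rewrite w'E /f /le_perm.
  by rewrite (negPf iC) (negPf jC) leq_add2r.
rewrite iC (negPf jC) mul1n mul0n; apply/negP.
by have := ltn_ord ((w^-1)%g i); have := ltn_ord ((w^-1)%g j); lia.
Qed.

(* The orders of [w] and [w'] agree off [C], which comes last for [w] and first
   for [w']. *)
Section Move.
Variables (w w' : {perm 'I_n}) (C S : {set 'I_n}).
Hypothesis agree : forall i j, i \notin C -> j \notin C -> le_perm w' i j = le_perm w i j.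
Hypothesis upper : forall i j, i \in C -> j \notin C -> le_perm w i j = false.
Hypothesis lower : forall i j, i \in C -> j \notin C -> le_perm w' j i = false.
Hypothesis CS : C \subset S.

(** [C] is a downset for [w'], and [S :\: C] has no element in it. *)
Lemma gale_move_disjoint T' : gale w' (S :\: C)%SET T' -> (T' :&: C = finset.set0)%SET.
Proof.
move=> /galeP[_ /(_ C)]; rewrite (_ : ((S :\: C) :&: C = finset.set0)%SET); last first.
  by apply/setP => i; rewrite !inE; case: (i \in C); rewrite ?andbF.
rewrite finset.cards0 leqn0 finset.cards_eq0 => h; apply/eqP; apply: h.
by move=> i j + jC; apply: contraTT => iC; rewrite lower.
Qed.

(** The complement of [C] is a [w]-downset, and counting on it forces [C] into [T]. Removing [C]
    turns a [w']-downset into a [w]-downset. Conversely a [w]-downset either misses [C], and its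
    union with [C] is a [w']-downset, or meets [C] and contains everything off [C]. *)
Lemma gale_move T : gale w S T <-> C \subset T /\ gale w' (S :\: C)%SET (T :\: C)%SET.
Proof.
split=> [/galeP[ST cnt]|[CT gST]].
  have CT : C \subset T.
    have upC : downset w (~: C)%SET.
      move=> i j ij; rewrite !inE; apply: contra => iC.
      by apply/negPn/negP => jC; rewrite upper in ij.
    have := cnt _ upC; rewrite -!finset.setDE => TS.
    have := finset.cardsID C S; have := finset.cardsID C T.
    rewrite (finset.setIidPr CS) => hT hS.
    have : (#|C| <= #|T :&: C|)%N by move: ST TS hT hS; lia.
    by move=> h; apply/finset.setIidPr/eqP; rewrite finset.eqEcard finset.subsetIr.
  split=> //; apply/galeP; split.
    by rewrite !finset.cardsD !(finset.setIidPr _) // ST.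
  move=> D Dd; have E (A : {set 'I_n}) : ((A :\: C) :&: D = A :&: (D :\: C))%SET.
    by rewrite finset.setIDAC finset.setIDA.
  rewrite !E; apply: cnt => i j ij; rewrite !finset.in_setD => /andP[jC jD].
  have iC : i \notin C by apply/negP => iC; rewrite upper in ij.
  by rewrite iC; apply: Dd jD; rewrite agree.
have /galeP[cardST cnt] := gST.
have ST : #|S| = #|T|.
  by rewrite -(finset.cardsID C S) -(finset.cardsID C T) cardST !(finset.setIidPr _).
apply/galeP; split=> // D Dd.
have splitD (A : {set 'I_n}) : C \subset A ->
  #|A :&: D|%SET = (#|C :&: D| + #|(A :\: C) :&: D|)%SET.
  move=> CA; rewrite -(finset.cardsID C (A :&: D)%SET) finset.setIAC (finset.setIidPr CA).
  by rewrite [((A :\: C) :&: D)%SET]finset.setIDAC.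
rewrite (splitD S CS) (splitD T CT) leq_add2l.
have [CD0|/set0Pn[c]] := eqVneq (C :&: D)%SET finset.set0.
  have DC : downset w' (D :|: C)%SET.
    move=> i j ij; rewrite !inE; have [//|iC] := boolP (i \in C); rewrite ?orbT //.
    have [jC|jC] := boolP (j \in C); first by rewrite lower in ij.
    by rewrite !orbF; apply: Dd; rewrite -agree.
  have E (A : {set 'I_n}) : ((A :\: C) :&: (D :|: C) = (A :\: C) :&: D)%SET.
    by apply/setP => i; rewrite !inE; case: (i \in C); rewrite ?andbF ?orbF.
  by have := cnt _ DC; rewrite !E.
rewrite finset.in_setI => /andP[cC cD].
have E (A : {set 'I_n}) : ((A :\: C) :&: D = A :\: C)%SET.
  apply/finset.setIidPl/fintype.subsetP => i; rewrite finset.in_setD => /andP[iC _].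
  apply: (Dd _ c) => //; have := le_perm_total w i c.
  by rewrite (upper cC iC) orbF.
by rewrite !E cardST.
Qed.

End Move.

(** Coloops come last for [w]: if a coloop lay below a non-coloop, exchanging it upwards in a basis
    avoiding the latter would give a basis without the coloop. Moving them to the front and dropping
    them from [S] makes them loops. *)
Lemma schubert_twist_coloops (M M' : matroid n) :
  bases M' = twist (bases M) (coloops (bases M)) -> schubert M -> schubert M'.
Proof.
move=> M'E /existsP[w /existsP[S /eqP ME]].
have MP T : (T \in bases M) = gale w S T by rewrite ME inE.
set C := coloops (bases M) in M'E.
have [w' [agree lower]] := le_perm_lower w C.
have upper i j : i \in C -> j \notin C -> le_perm w i j = false.
  move=> iC jC; apply/negP => ij; have /negP := jC; apply; apply/coloopsP => T MT.
  apply/negPn/negP => jT; have iT : i \in T by have /coloopsP := iC; apply.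
  have /coloopsP/(_ (j |: (T :\ i))%SET) := iC;
    rewrite MP gale_exchange -?MP // => /(_ isT).
  by rewrite !inE eqxx orbF => /eqP ij'; rewrite -ij' iC in jC.
have CS : C \subset S.
  apply/fintype.subsetP => i /coloopsP; apply; rewrite MP; exact: gale_refl.
apply/existsP; exists w'; apply/existsP; exists (S :\: C)%SET; apply/eqP/setP => T.
rewrite M'E in_twist MP inE; apply/idP/idP.
  move=> /(gale_move agree upper lower CS)[CT].
  rewrite (_ : (symdiff T C :\: C)%SET = T) //; apply/setP => i;
    rewrite finset.in_setD in_symdiff.
  have := fintype.subsetP CT i; rewrite in_symdiff.
  by case: (i \in C); case: (i \in T) => //= /(_ isT).
move=> gT; have TC := gale_move_disjoint lower gT.
have TC' i : i \in C -> i \notin T.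
  by move=> iC; apply/negP => iT; have /setP/(_ i) := TC;
    rewrite finset.in_setI finset.in_set0 iC iT.
apply/(gale_move agree upper lower CS); split.
  by apply/fintype.subsetP => i iC; rewrite in_symdiff iC (negPf (TC' i iC)).
rewrite (_ : (symdiff T C :\: C)%SET = T) //; apply/setP => i;
  rewrite finset.in_setD in_symdiff.
by have [/TC'/negPf->|] := boolP (i \in C); rewrite ?addbF.
Qed.

(** Dually, loops come first for [w'], since a non-loop below a loop could be exchanged for it. They
    are moved to the end and added to [S0]. *)
Lemma schubert_twist_loops (M M' : matroid n) :
  bases M' = twist (bases M) (loops (bases M)) -> schubert M -> schubert M'.
Proof.
move=> M'E /existsP[w' /existsP[S0 /eqP ME]].
have MP T : (T \in bases M) = gale w' S0 T by rewrite ME inE.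
set C := loops (bases M) in M'E.
have [w [agree' upper]] := le_perm_upper w' C.
have agree i j iC jC := esym (agree' i j iC jC).
have lower i j : i \in C -> j \notin C -> le_perm w' j i = false.
  move=> iC jC; apply/negP => ji; have /negP := jC; apply; apply/loopsP => T MT.
  apply/negP => jT; have iT : i \notin T by have /loopsP := iC; apply.
  have /loopsP/(_ (i |: (T :\ j))%SET) := iC; rewrite MP gale_exchange -?MP // => /(_ isT).
  by rewrite !inE eqxx.
have S0C i : i \in C -> i \notin S0.
  by move=> /loopsP; apply; rewrite MP; exact: gale_refl.
have S0E : S0 = ((S0 :|: C) :\: C)%SET.
  by apply/setP => i; rewrite finset.in_setD finset.in_setU;
    have [/S0C/negPf->|] := boolP (i \in C); rewrite ?orbF.
have CS := finset.subsetUr S0 C.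
apply/existsP; exists w; apply/existsP; exists (S0 :|: C)%SET; apply/eqP/setP => T.
rewrite M'E in_twist MP inE {1}S0E; apply/idP/idP.
  move=> gT; have TC := gale_move_disjoint lower gT.
  have TC' i : i \in C -> i \in T.
    move=> iC; apply/negPn/negP => iT; have /setP/(_ i) := TC.
    by rewrite !finset.in_setI in_symdiff finset.in_set0 iC (negPf iT).
  apply/(gale_move agree upper lower CS); split; first exact/fintype.subsetP.
  rewrite (_ : (T :\: C)%SET = symdiff T C) //; apply/setP => i;
    rewrite finset.in_setD in_symdiff.
  by have [/TC'->|] := boolP (i \in C); rewrite ?addbF.
move=> /(gale_move agree upper lower CS)[CT].
rewrite (_ : (T :\: C)%SET = symdiff T C) //; apply/setP => i;
  rewrite finset.in_setD in_symdiff.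
by have [/(fintype.subsetP CT)->|] := boolP (i \in C); rewrite ?addbF.
Qed.

End Gale.

(** * Coordinate reflections and Schubert delta matroids *)

Section ReflectedPolytopes.
Context {R : realType} {n : nat}.
Implicit Types (F : {set {set 'I_n}}) (A B C : {set 'I_n}) (x : 'rV[R]_n).

Definition reflect_coords C x : 'rV[R]_n := \row_i (if i \in C then 1 - x 0 i else x 0 i).

Lemma reflect_evec C B : reflect_coords C (evec B) = evec (symdiff B C).
Proof.
apply/rowP => i; rewrite !mxE in_symdiff.
by case: (i \in C); case: (i \in B); rewrite ?subr0 ?subrr.
Qed.

Lemma indicator_polytope_twist F C :
  indicator_polytope (twist F C) = reflect_coords C @` indicator_polytope F :> set 'rV[R]_n.
Proof.
rewrite conv_image; last first.
  move=> m t p t1; apply/rowP => i; rewrite !mxE !summxE.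
  case: ifP => iC; last by apply: eq_bigr => j _; rewrite !mxE iC.
  rewrite -t1 -sumrB; apply: eq_bigr => j _.
  by rewrite !mxE iC mulrBr mulr1.
congr conv; apply/seteqP; split=> x.
  move=> [B + <-]; rewrite /= in_twist => FB.
  by exists (evec (symdiff B C)); [exists (symdiff B C) | rewrite reflect_evec symdiffK].
move=> [_ [B /= FB <-] <-]; exists (symdiff B C); last by rewrite reflect_evec.
exact: twist_symdiff.
Qed.

(** Every member contains the coloops, so the twist is a translation by minus their indicator. *)
Lemma vertex_polytope_twist_coloops F t :
  vertex_polytope F t =
  vertex_polytope (twist F (coloops F)) (t + ivec (coloops F)) :> set 'rV[R]_n.
Proof.
rewrite /vertex_polytope map_mxD addrC vecR_ivec -translateD; congr translate.
have evecE B : B \in F ->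
    evec (symdiff B (coloops F)) + evec (coloops F) = evec B :> 'rV[R]_n.
  move=> FB; apply/rowP => i; rewrite !mxE in_symdiff.
  have [/coloopsP/(_ _ FB)->|_] := boolP (i \in coloops F); first by rewrite add0r.
  by rewrite addbF addr0.
rewrite conv_translate; congr conv; apply/seteqP; split=> x.
  move=> [B /= FB <-]; exists (evec (symdiff B (coloops F))); last exact: evecE.
  by exists (symdiff B (coloops F)) => //; apply: twist_symdiff.
move=> [_ [B + <-] <-]; rewrite /= in_twist => /[dup] FB /evecE.
by rewrite symdiffK => ->; exists (symdiff B (coloops F)).
Qed.

Local Notation pm := (bool * 'I_n)%type.

(** If two images agreed up to sign only, the image of the negative of one element would be that of
    the other. *)
Lemma signed_perm_abs_inj (w : {perm pm}) : signed_perm w ->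
  injective (fun i => (w (false, i)).2).
Proof.
move=> /forallP sw i i' e; have /forallP/(_ i)/eqP wi := sw false.
have [e1|e1] := eqVneq (w (false, i)).1 (w (false, i')).1.
  have : w (false, i) = w (false, i').
    by rewrite [LHS]surjective_pairing [RHS]surjective_pairing e e1.
  by move=> /perm_inj [].
have : w (true, i) = w (false, i').
  rewrite (wi : w (true, i) = _) [RHS]surjective_pairing e; congr pair.
  by move: e1; case: (w (false, i)).1; case: (w (false, i')).1.
by move=> /perm_inj [].
Qed.

(* The twist by [C] is the reflection of the coordinates in [C], which amounts to
   changing the signs of [w] at [C]. *)
Lemma schubert_delta_twist (D D' : delta_matroid n) C :
  feasible D' = twist (feasible D) C -> schubert_delta R D -> schubert_delta R D'.
Proof.
move=> D'E /asboolP[w [S [sw DE]]]; apply/asboolP.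
pose flip (p : pm) : pm := (p.1 (+) (p.2 \in C), p.2).
have flip_inj : injective flip.
  by move=> [b i] [b' i'] [/[swap] ->]; case: (i' \in C); case: b; case: b'.
pose w' := (w * perm flip_inj)%g.
have w'E b i : w' (b, i) = ((w (b, i)).1 (+) ((w (b, i)).2 \in C), (w (b, i)).2).
  by rewrite permM permE.
have sw' : signed_perm w'.
  apply/forallP => b; apply/forallP => i; rewrite !w'E.
  have /forallP/(_ b)/forallP/(_ i)/eqP -> := sw.
  by rewrite /= addNb.
exists w', S; split=> //; rewrite /FP D'E indicator_polytope_twist.
rewrite [indicator_polytope _]DE /translate !image_comp; congr image.
apply/funext => x /=; apply/rowP => j; have w_inj := signed_perm_abs_inj sw.
have [g _ /(_ j) <-] := injF_bij w_inj; set i := g j.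
(* At the position of the image of [i], the signed action followed by the translation gives [x 0 i]
   or [1 - x 0 i] according to the sign, so flipping the sign is a reflection. *)
have coordE (v : {perm pm}) : (forall i, (v (false, i)).2 = (w (false, i)).2) ->
    (signed_act v x + evec (neg_set v)) 0 (w (false, i)).2 =
    if (v (false, i)).1 then 1 - x 0 i else x 0 i.
  move=> vw; have sgE i' : ((w (false, i')).2 == (w (false, i)).2) = (i' == i).
    exact: (inj_eq w_inj).
  rewrite !mxE summxE (bigD1 i) //= big1 ?addr0; last first.
    by move=> i' i'i; rewrite !mxE vw eq_sym sgE (negPf i'i) andbF !mulr0.
  rewrite !mxE vw !eqxx /=.
  have -> : ((w (false, i)).2 \in neg_set v) = (v (false, i)).1.
    apply/imsetP/idP => [[i' + /eqP]|vi]; last by exists i; rewrite ?inE ?vw.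
    by rewrite inE vw eq_sym sgE => + /eqP <-.
  by case: (v (false, i)).1 => /=; ring.
rewrite mxE !coordE // => [|i']; last by rewrite w'E.
by rewrite w'E /=; case: (_ \in C); case: (w (false, i)).1; rewrite //= subKr.
Qed.

End ReflectedPolytopes.

(** * From loopless summands to coloopless objects *)

Section LooplessToColoopless.
Context {n : nat}.
Variables (T : finType) (fam : T -> {set {set 'I_n}}) (Q : pred T).
Hypothesis fam_inj : injective fam.
Hypothesis fam_neq0 : forall x, fam x != finset.set0.
Hypothesis twist_coloops : forall x, Q x ->
  exists2 y, Q y & fam y = twist (fam x) (coloops (fam x)).
Hypothesis twist_loops : forall x, Q x ->
  exists2 y, Q y & fam y = twist (fam x) (loops (fam x)).

Local Notation loopless_part := {x : T | Q x && loopless (fam x)}.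
Local Notation coloopless_part := {x : T | Q x && coloopless (fam x)}.

Lemma loopless_coloopless_bij :
  exists (f : loopless_part -> coloopless_part) (g : coloopless_part -> loopless_part),
  [/\ cancel f g, cancel g f
    & forall i, fam (val (f i)) = twist (fam (val i)) (coloops (fam (val i)))].
Proof.
have /choice[f fE] (i : loopless_part) : exists y : coloopless_part,
    fam (val y) = twist (fam (val i)) (coloops (fam (val i))).
  have /andP[Qi _] := valP i; have [y Qy yE] := twist_coloops Qi.
  have yP : Q y && coloopless (fam y) by rewrite Qy yE coloopless_twist.
  by exists (exist (fun y => Q y && coloopless (fam y)) y yP).
have /choice[g gE] (i : coloopless_part) : exists y : loopless_part,
    fam (val y) = twist (fam (val i)) (loops (fam (val i))).
  have /andP[Qi _] := valP i; have [y Qy yE] := twist_loops Qi.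
  have yP : Q y && loopless (fam y) by rewrite Qy yE loopless_twist.
  by exists (exist (fun y => Q y && loopless (fam y)) y yP).
exists f, g; split=> // i; apply/val_inj/fam_inj; have /andP[_ iP] := valP i.
  by rewrite gE fE loops_twist // twistK.
by rewrite fE gE coloops_twist // twistK.
Qed.

Context {R : realType}.
Variables (k : comNzRingType) (X : toric_fan R n).
Hypothesis zero_cone : cones X (ray X 0).
Hypothesis zero_cone_sub : forall S, cones X S -> ray X 0 `<=` S.
Hypothesis lin_saturated : forall v (b : R),
  vecR R v = b *: vecR R (lin X) -> exists d, v = d *: lin X.
Hypothesis fam_cut : forall x t,
  (forall B, B \in fam x -> charM X (ivec B + t)) -> cut_by_rays X (fam x) t.
Variables (m : T -> 'rV[int]_n) (P : T -> set 'rV[R]_n).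
Hypothesis PE : forall x, P x = vertex_polytope (fam x) (m x).
Hypothesis P_MR : forall x, P x `<=` MR X.

Definition aug_incl_cat : fincat :=
  @set_cat n T (fun x y => aug_incl (fam x) (fam y))
    (fun x => aug_incl0 _) (fun _ _ _ _ _ => @aug_inclU n _ _ _ _ _).

(** Each summand stays as it is, but its polytope is read as a translate of that of the coloopless
    family [f i]; the extra translation is the indicator of the loops of that family. *)
Theorem tilting_aug_incl :
  (exists phi :
     catalg k (full_subcat (C := aug_incl_cat) (fun x : T => Q x && coloopless (fam x))) ->
     oxend (dsum (fun i : loopless_part => polytope_bundle k X (P (val i)))),
     [/\ bijective phi, linear phi & monoid_morphism phi]) /\
  (exists2 f : loopless_part -> coloopless_part, bijective f &
     forall i, oxiso (polytope_bundle k X (P (val i))) (polytope_bundle k X (P (val (f i))))).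
Proof.
have P_char x B : B \in fam x -> charM X (ivec B + m x).
  move=> xB; apply/eqP; rewrite -(eqr_int R) -dot_vecR; apply/eqP.
  by apply: (@P_MR x); rewrite PE; apply: vertexP.
have [f [g [fK gK fE]]] := loopless_coloopless_bij.
have loops_f i : loops (fam (val (f i))) = coloops (fam (val i)).
  by have /andP[_ iP] := valP i; rewrite fE loops_twist.
have PEf i : P (val i) = vertex_polytope (fam (val (f i)))
    (m (val i) + ivec (loops (fam (val (f i))))).
  by rewrite PE vertex_polytope_twist_coloops -fE loops_f.
have char_f i B : B \in fam (val (f i)) ->
    charM X (ivec B + (m (val i) + ivec (loops (fam (val (f i)))))).
  move=> iB; apply/eqP; rewrite -(eqr_int R) -dot_vecR; apply/eqP.
  by apply: (@P_MR (val i)); rewrite PEf; apply: vertexP.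
split.
  pose C := full_subcat (C := aug_incl_cat) (fun x : T => Q x && coloopless (fam x)).
  apply: (@catalg_oxend_polytopes R n k X zero_cone zero_cone_sub lin_saturated C _ g f
    gK fK (fun x : C => fam (val x))
    (fun x : C => m (val (g x)) + ivec (loops (fam (val x))))
    (fun i => P (val i)) (fun x y (h : Defs.hom x y) => val h)).
  - by move=> x y; apply: val_inj.
  - by [].
  - move=> x y S; split=> [xyS|[h <-]]; last exact: valP h.
    by exists (exist (fun S => aug_incl (fam (val x)) (fam (val y)) S) S xyS).
  - by move=> x; apply: fam_neq0.
  - by move=> x; have /andP[] := valP x.
  - by move=> i; rewrite fK PEf.
  - by move=> i; apply: P_MR.
  - move=> x; apply: fam_cut => B xB.
    by have := @char_f (g x) B; rewrite gK; apply.
exists f; first by exists g.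
move=> i; rewrite PEf PE; apply: oxiso_vertex_polytope; first exact: fam_neq0.
have /set0Pn[B iB] := fam_neq0 (val (f i)).
(* The two translations differ by a difference of vertices with the same [B], and both vertices are
   characters. *)
rewrite (_ : _ - _ = (ivec B + (m (val i) + ivec (loops (fam (val (f i)))))) -
  (ivec B + m (val (f i)))); last by rewrite opprD addrACA subrr add0r.
by rewrite /charM dotBl (char_f i B iB) (P_char _ _ iB) subrr.
Qed.

End LooplessToColoopless.

(** * The tilting algebras of the three varieties *)

Theorem proposition1p4 (R : realType) (k : closedFieldType)
    (k_char0 : [pchar k] =i pred0) (n : nat) (n_gt0 : (0 < n)%N) :
  (* (1), for any choice of translations [m] moving base polytopes into M_R *)
  (forall m : matroid n -> 'rV[int]_n,
     (forall M, translate (BP M) (vecR R (m M)) `<=` MR (Perm R n)) ->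
     let L (M : matroid n) :=
       polytope_bundle k (Perm R n) (translate (BP M) (vecR R (m M))) in
     let loopless_schubert := {M : matroid n | schubert M && loopless M} in
     let coloopless_schubert := {M : matroid n | schubert M && coloopless M} in
     (exists phi :
        catalg k (full_subcat (C := aug_incl_matroids n)
                    (fun M : matroid n => schubert M && coloopless M)) ->
        oxend (dsum (fun M : loopless_schubert => L (val M))),
        [/\ bijective phi, linear phi & monoid_morphism phi]) /\
     (exists2 f : loopless_schubert -> coloopless_schubert,
        bijective f & forall M, oxiso (L (val M)) (L (val (f M))))) /\
  (* (2) *)
  (exists phi :
     catalg k (full_subcat (C := aug_weak_matroids n)
                 (fun M : matroid n => schubert M)) ->
     oxend (dsum (fun M : {M : matroid n | schubert M} =>
       polytope_bundle k (Stell R n) (IP (val M)))),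
     [/\ bijective phi, linear phi & monoid_morphism phi]) /\
  (* (3) *)
  (let L (D : delta_matroid n) := polytope_bundle k (PermB R n) (FP D) in
   let loopless_schubert :=
     {D : delta_matroid n | schubert_delta R D && loopless D} in
   let coloopless_schubert :=
     {D : delta_matroid n | schubert_delta R D && coloopless D} in
   (exists phi :
      catalg k (full_subcat (C := aug_incl_deltas n)
                  (fun D : delta_matroid n => schubert_delta R D && coloopless D)) ->
      oxend (dsum (fun D : loopless_schubert => L (val D))),
      [/\ bijective phi, linear phi & monoid_morphism phi]) /\
   (exists2 f : loopless_schubert -> coloopless_schubert,
      bijective f & forall D, oxiso (L (val D)) (L (val (f D))))).
Proof.
have matroid_neq0 (M : matroid n) : bases M != finset.set0 by case/andP: (matroidP M).
have delta_neq0 (D : delta_matroid n) : feasible D != finset.set0.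
  by case/andP: (delta_matroidP D).
have MR_lin0 (X : toric_fan R n) (S : set 'rV[R]_n) : lin X = 0 -> S `<=` MR X.
  by move=> X0 x _; rewrite /MR /= X0 map_mx0 /dot big1 // => i _; rewrite mxE mulr0.
split; [|split].
- move=> m P_MR.
  have zero_cone : cones (Perm R n) (ray (Perm R n) 0).
    rewrite -ivec0; apply: Perm_ray => //; apply/eqP => /setP/(_ (Ordinal n_gt0)).
    by rewrite !inE.
  apply: (@tilting_aug_incl n (matroid n) (@bases n) (@schubert n) _ matroid_neq0 _ _
    R k (Perm R n) zero_cone (@Perm_lin_sub R n) (Perm_lin_saturated n_gt0) _ m
    (fun M => translate (BP M) (vecR R (m M)))) => //.
  + exact: val_inj.
  + move=> M sM; have tM := matroid_twist (finset.subsetUr _ _) (matroidP M).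
    by exists (Matroid tM) => //; apply: schubert_twist_coloops sM.
  + move=> M sM; have tM := matroid_twist (finset.subsetUl _ _) (matroidP M).
    by exists (Matroid tM) => //; apply: schubert_twist_loops sM.
  + by move=> M t; apply: Perm_cut_by_rays.
- pose C := full_subcat (C := aug_weak_matroids n) (fun M : matroid n => schubert M).
  have indepP (M : matroid n) (I : {set 'I_n}) : reflect (exists2 B,
    B \in bases M & I \subset B)
      (I \in independents (bases M)) by rewrite inE; apply: exists_inP.
  have indep0 (M : matroid n) : finset.set0 \in independents (bases M).
    by have /set0Pn[B MB] := matroid_neq0 M; apply/indepP; exists B;
      rewrite ?finset.sub0set.
  have zero_cone : cones (Stell R n) (ray (Stell R n) 0).
    by rewrite -ivec0; apply: Stell_ray_set.
  apply: (@catalg_oxend_polytopes R n k (Stell R n) zero_cone (@Stell_lin_sub R n)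
    (lin0_saturated (erefl : lin (Stell R n) = 0)) C _ id id _ _
    (fun x : C => independents (bases (val x))) (fun=> 0)
    (fun M => IP (val M)) (fun x y (h : Defs.hom x y) => val h)) => //.
  (* Augmented weak maps are augmented inclusions of the families of independent sets, which have
     the same loops as the families of bases. *)
  + have weakE F1 F2 : aug_weak F1 F2 =1 aug_incl (@independents n F1) (independents F2).
      have loopsE : loops (independents F1) = loops F1.
        by apply/setP => i; rewrite [RHS]loops_indep inE.
      by move=> S; rewrite /aug_weak /aug_incl loopsE.
    move=> x y S; rewrite -weakE; split=> [xyS|[h <-]]; last exact: valP h.
    by exists (exist (fun S => aug_weak (bases (val x)) (bases (val y)) S) S xyS).
  + by move=> x; apply/set0Pn; exists finset.set0; apply: indep0.
  (* The empty set is independent, so a family of independent sets has no coloops. *)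
  + move=> x; apply/eqP/setP => i; rewrite finset.in_set0; apply/negP => /coloopsP.
    by move=> /(_ _ (indep0 _)); rewrite finset.in_set0.
  + by move=> M; rewrite /vertex_polytope map_mx0 translate0.
  + by move=> M; apply: MR_lin0.
  + move=> x; apply: Stell_cut_by_rays.
      by apply/set0Pn; exists finset.set0; apply: indep0.
    move=> A B AB /indepP[B' MB' BB']; apply/indepP; exists B' => //.
    exact: fintype.subset_trans BB'.
- have zero_cone : cones (PermB R n) (ray (PermB R n) 0).
    by apply: PermB_ray => i; rewrite mxE.
  apply: (@tilting_aug_incl n (delta_matroid n) (@feasible n) (@schubert_delta R n) _ delta_neq0
    _ _ R k (PermB R n) zero_cone (@PermB_lin_sub R n)
    (lin0_saturated (erefl : lin (PermB R n) = 0)) _ (fun=> 0) (fun D => FP D)) => //.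
  + exact: val_inj.
  + move=> D sD; exists (DeltaMatroid (delta_twist (coloops (feasible D)) (delta_matroidP D))) => //.
    by apply: schubert_delta_twist sD.
  + move=> D sD; exists (DeltaMatroid (delta_twist (loops (feasible D)) (delta_matroidP D))) => //.
    by apply: schubert_delta_twist sD.
  + by move=> D t _; apply: PermB_cut_by_rays.
  + by move=> D; rewrite /vertex_polytope map_mx0 translate0.
  + by move=> D; apply: MR_lin0.
Qed.
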